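(* There exists an absolute constant $C>0$ such that the following holds. Suppose that $\varepsilon>0$, $K$ and $D$ are origin-symmetric convex bodies in $\mathbb{R}^n$, and $D$ is a projection body which is a dilate of an isotropic body. If for every $\xi\in S^{n-1}$ $$P_K(\xi)\le P_D(\xi)+\varepsilon,$$ then $$|K|^{\frac{n-1}{n}}\le |D|^{\frac{n-1}{n}}+C\,\varepsilon\,\log^2(1+n)\,L_D.$$
   Context: A convex body in $\mathbb{R}^n$ is a compact convex set with nonempty interior; it is origin-symmetric if $K=-K$. $|\cdot|$ denotes volume of the proper dimension. For an origin-symmetric convex body $K$ in $\mathbb{R}^n$ and $\xi\in S^{n-1}$, $K\vert\xi^\perp$ is the orthogonal projection of $K$ onto the hyperplane $\xi^\perp$ through the origin perpendicular to $\xi$, and the projection function of $K$ is $P_K(\xi)=|K\vert\xi^\perp|$. The support function of an origin-symmetric convex body $K$ is $h_K(x)=\max_{\xi\in K}(x,\xi)$, $x\in\mathbb{R}^n$. The projection body $\Pi K$ of an origin-symmetric convex body $K$ is the origin-symmetric convex body defined by $h_{\Pi K}(\theta)=|K\vert\theta^\perp|$ for all $\theta\in S^{n-1}$. A body $L$ is called a projection body if it is the projection body of some convex body. A body $K$ is in isotropic position (is isotropic) if $|K|=1$ and there is a constant $L_K>0$ such that $\int_K (x,\xi)^2\,dx=L_K^2$ for all $\xi\in S^{n-1}$. For every origin-symmetric convex body $K$ there is $T\in GL_n$ such that $TK$ is in isotropic position, and the corresponding constant, denoted $L_K$, is the isotropic constant of $K$. A body $D$ is a dilate of an isotropic body if $tD$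 is in isotropic position for some $t>0$ (then $L_D=L_{tD}$). ''Absolute constant'' means independent of $n$, $\varepsilon$ and the bodies. $\log^2(1+n)=(\log(1+n))^2$. *)

(* Defs.v *)
From HB Require Import structures.
From mathcomp Require Import all_boot all_order all_algebra.
From mathcomp Require Import all_classical all_reals all_analysis.
From mathcomp Require Import ring.

Set Implicit Arguments.
Unset Strict Implicit.
Unset Printing Implicit Defensive.

Import Order.TTheory GRing.Theory Num.Theory.
Import numFieldNormedType.Exports.

Local Open Scope classical_set_scope.
Local Open Scope ring_scope.

Section measurable_rV.
Context (R : realType) (n : nat).

Let coord_rV : 'I_n -> 'rV[R]_n -> measurableTypeR R := fun i x => x ord0 i.

Let rV_set0 : g_sigma_preimage coord_rV set0.
Proof. exact: sigma_algebra0. Qed.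

Let rV_setC A : g_sigma_preimage coord_rV A -> g_sigma_preimage coord_rV (~` A).
Proof. exact: sigma_algebraC. Qed.

Let rV_bigcup (F : (set 'rV[R]_n)^nat) :
  (forall i, g_sigma_preimage coord_rV (F i)) ->
  g_sigma_preimage coord_rV (\bigcup_i F i).
Proof. exact: sigma_algebra_bigcup. Qed.

HB.instance Definition _ := @isMeasurable.Build default_measure_display
  'rV[R]_n (g_sigma_preimage coord_rV) rV_set0 rV_setC rV_bigcup.

End measurable_rV.

Lemma measurable_coord_rV (R : realType) n (i : 'I_n) :
  measurable_fun [set: 'rV[R]_n] (fun x => x ord0 i : measurableTypeR R).
Proof.
move=> _ Y mY; rewrite setTI; apply: sub_sigma_algebra => /=.
rewrite -bigcup_seq/=; exists i => /=; first by rewrite mem_index_enum.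
by exists Y => //; rewrite setTI.
Qed.

Lemma measurable_fun_rVP (R : realType) n d (T : measurableType d)
    (f : T -> 'rV[R]_n) :
  (forall i, measurable_fun [set: T] (fun t => f t ord0 i : measurableTypeR R))
  -> measurable_fun [set: T] f.
Proof.
move=> mf _ A mA; rewrite setTI.
pose h (i : 'I_n) (x : 'rV[R]_n) : measurableTypeR R := x ord0 i.
suff : g_sigma_preimage (fun i => h i \o f) `<=` measurable.
  by rewrite g_sigma_preimage_comp; apply; exists A => //; rewrite setTI.
apply: smallest_sub; first exact: sigma_algebra_measurable.
rewrite -bigcup_seq/=; apply: bigcup_sub => i _ _ [B mB <-].
exact: mf.
Qed.

(** Lebesgue measure on [R^n] is the iterated product of the one on [R],
    transported along [R * R^n ~ R^(n+1)]; see [lebesgue_rV_box]. *)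

Section lebesgue_rV.
Context (R : realType).

Definition cons_rV n (p : measurableTypeR R * 'rV[R]_n) : 'rV[R]_n.+1 :=
  \row_i oapp (p.2 ord0) p.1 (unlift ord0 i).

Definition uncons_rV n (x : 'rV[R]_n.+1) : measurableTypeR R * 'rV[R]_n :=
  (x ord0 ord0, \row_i x ord0 (lift ord0 i)).

Lemma cons_rV0 n p : @cons_rV n p ord0 ord0 = p.1.
Proof. by rewrite mxE unlift_none. Qed.

Lemma cons_rVS n p i : @cons_rV n p ord0 (lift ord0 i) = p.2 ord0 i.
Proof. by rewrite mxE liftK. Qed.

Lemma cons_rVK n : cancel (@cons_rV n) (@uncons_rV n).
Proof.
move=> p; rewrite /uncons_rV cons_rV0 [RHS]surjective_pairing; congr pair.
by apply/rowP => i; rewrite mxE cons_rVS.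
Qed.

Lemma uncons_rVK n : cancel (@uncons_rV n) (@cons_rV n).
Proof.
move=> x; apply/rowP => i; have [j ->|->] := unliftP ord0 i.
  by rewrite cons_rVS mxE.
by rewrite cons_rV0.
Qed.

Lemma measurable_cons_rV n : measurable_fun setT (@cons_rV n).
Proof.
apply: measurable_fun_rVP => i; have [j ->|->] := unliftP ord0 i.
  rewrite (_ : (fun _ => _) =
    (fun x : 'rV[R]_n => x ord0 j : measurableTypeR R) \o snd).
    by apply: measurableT_comp => //; exact: measurable_coord_rV.
  by apply/funext => p; rewrite cons_rVS.
rewrite (_ : (fun _ => _) = fst)//.
by apply/funext => p; rewrite cons_rV0.
Qed.

Lemma measurable_uncons_rV n : measurable_fun setT (@uncons_rV n).
Proof.
apply/measurable_fun_pair; first exact: measurable_coord_rV.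
apply: measurable_fun_rVP => i.
rewrite (_ : (fun _ => _) =
  fun x : 'rV[R]_n.+1 => x ord0 (lift ord0 i) : measurableTypeR R).
  exact: measurable_coord_rV.
by apply/funext => x; rewrite mxE.
Qed.

Section step.
Context n (mu : {sigma_finite_measure set 'rV[R]_n -> \bar R}).

Definition lebesgue_rV_step : set 'rV[R]_n.+1 -> \bar R :=
  pushforward (lebesgue_measure \x mu)%E (@cons_rV n).

Let pf : {measure set 'rV[R]_n.+1 -> \bar R} :=
  measure_function_pushforward__canonical__measure_function_Measure
    (lebesgue_measure \x mu)%E (@measurable_cons_rV n).

Let step0 : lebesgue_rV_step set0 = 0%E.
Proof. exact: (measure0 pf). Qed.

Let step_ge0 A : (0 <= lebesgue_rV_step A)%E.
Proof. exact: (measure_ge0 pf). Qed.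

Let step_sigma_additive : semi_sigma_additive lebesgue_rV_step.
Proof. exact: (@measure_semi_sigma_additive _ _ _ pf). Qed.

HB.instance Definition _ := isMeasure.Build _ _ _
  lebesgue_rV_step step0 step_ge0 step_sigma_additive.

Let step_sigma_finite : sigma_finite setT lebesgue_rV_step.
Proof.
have /sigma_finiteP[F [UF ndF mF]] := sigma_finiteT (@lebesgue_measure R).
have /sigma_finiteP[G [UG ndG mG]] := sigma_finiteT mu.
exists (fun k => @uncons_rV n @^-1` (F k `*` G k)).
  rewrite -preimage_bigcup; apply/esym/seteqP; split=> // x _ /=.
  have [i _ Fi] : (\bigcup_i F i) (uncons_rV x).1 by rewrite -UF.
  have [j _ Gj] : (\bigcup_i G i) (uncons_rV x).2 by rewrite -UG.
  exists (maxn i j) => //; split.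
    by move: Fi; exact/subsetPset/ndF/leq_maxl.
  by move: Gj; exact/subsetPset/ndG/leq_maxr.
move=> k; have [mFk Fk] := mF k; have [mGk Gk] := mG k; split.
  rewrite -[X in measurable X]setTI; apply: measurable_uncons_rV => //.
  exact: measurableX.
rewrite /lebesgue_rV_step /pushforward -comp_preimage.
rewrite (_ : _ \o _ = id); last by apply/funext => p; exact: cons_rVK.
by rewrite preimage_id product_measure1E// lte_mul_pinfty// ge0_fin_numE.
Qed.

HB.instance Definition _ := Measure_isSigmaFinite.Build _ _ _
  lebesgue_rV_step step_sigma_finite.

End step.

Fixpoint lebesgue_rV n : {sigma_finite_measure set 'rV[R]_n -> \bar R} :=
  if n is m.+1 then lebesgue_rV_step (lebesgue_rV m)
  else \d_(0 : 'rV[R]_0).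

End lebesgue_rV.
Arguments lebesgue_rV {R} n.

Lemma lebesgue_rV_box (R : realType) n (A : 'I_n -> set (measurableTypeR R)) :
  (forall i, measurable (A i)) ->
  lebesgue_rV n [set x : 'rV[R]_n | forall i, A i (x ord0 i)] =
  (\prod_(i < n) lebesgue_measure (A i))%E.
Proof.
elim: n A => [|n IH] A mA /=.
  by rewrite big_ord0 diracE mem_set// => -[].
rewrite /lebesgue_rV_step /pushforward.
pose B := [set x : 'rV[R]_n | forall i, A (lift ord0 i) (x ord0 i)].
rewrite (_ : _ @^-1` _ = A ord0 `*` B); last first.
  apply/seteqP; split=> [p /= pA|p /= [p0 pB] i].
    split; first by have := pA ord0; rewrite cons_rV0.
    by move=> i; have := pA (lift ord0 i); rewrite cons_rVS.
  by have [j ->|->] := unliftP ord0 i; rewrite (cons_rVS, cons_rV0).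
have mB : measurable B.
  rewrite (_ : B = \bigcap_(i in [set: 'I_n])
    ((fun x : 'rV[R]_n => x ord0 i : measurableTypeR R) @^-1` A (lift ord0 i))).
    apply: fin_bigcap_measurable => // i _; rewrite -[X in measurable X]setTI.
    exact: measurable_coord_rV.
  by apply/seteqP; split=> [x xB i _|x xB i]; [exact: xB|exact: (xB i)].
rewrite product_measure1E//= big_ord_recl; congr (_ * _)%E.
exact: IH.
Qed.

Section convex_bodies.
Context (R : realType) (n : nat).
Implicit Types (x y xi : 'rV[R]_n) (K L : set 'rV[R]_n).

Definition volume K : R := fine (lebesgue_rV n K).

Definition dotv x y : R := \sum_i x ord0 i * y ord0 i.

Definition sphere : set 'rV[R]_n := [set xi | dotv xi xi = 1].

Definition convex_body K := [/\ compact K, convex_set K & K° !=set0].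

Definition origin_symmetric K := K = -%R @` K.

Definition proj_perp xi K : set 'rV[R]_n := [set x - dotv x xi *: xi | x in K].

(** The rows of [B] form an orthonormal basis of the hyperplane [xi^perp], so
    that [y |-> y *m B] is a linear isometry of [R^(n-1)] onto [xi^perp]. *)
Definition perp_frame xi : set 'M[R]_(n.-1, n) :=
  [set B | B *m B^T = 1%:M /\ B *m xi^T = 0].

End convex_bodies.
Arguments sphere {R n}.

Lemma perp_frame_nonempty (R : realType) n (xi : 'rV[R]_n) :
  (0 < n)%N -> sphere xi -> perp_frame xi !=set0.
Proof.
case: n xi => // n xi _ xi1.
pose e : 'rV[R]_n.+1 := delta_mx ord0 ord_max.
pose v := xi - e.
pose c := dotv v v.
have dotE (x y : 'rV[R]_n.+1) : x *m y^T = (dotv x y)%:M.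
  apply/matrixP => i j; rewrite !ord1 !mxE mulr1n.
  by apply: eq_bigr => k _; rewrite mxE.
suff [H [HH Hxi]] : exists H : 'M[R]_n.+1, H *m H^T = 1%:M /\ e *m H = xi.
  exists (row' ord_max H); split; apply/matrixP => i j.
    have := congr1 (fun M : 'M[R]_n.+1 => M (lift ord_max i) (lift ord_max j)) HH.
    rewrite !mxE (inj_eq (@lift_inj _ _)) => <-.
    by apply: eq_bigr => k _; rewrite !mxE.
  have := congr1 (fun M : 'M[R]_n.+1 => M (lift ord_max i) ord_max) HH.
  rewrite !mxE eq_sym (negbTE (neq_lift _ _)) /= => H0; rewrite -[RHS]H0.
  apply: eq_bigr => k _.
  by rewrite -Hxi -rowE !mxE.
have [v0|v0] := eqVneq c 0.
  have v_eq0 : v = 0.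
    apply/rowP => i; rewrite [RHS]mxE; apply/eqP; move/eqP: v0.
    rewrite psumr_eq0 => [/allP/(_ i)|j _]; last exact: sqr_ge0.
    by rewrite mem_index_enum => /(_ isT); rewrite mulf_eq0 orbb.
  exists 1%:M; rewrite trmx1 !mulmx1; split=> //.
  by rewrite -[RHS](subrK e) -/v v_eq0 add0r.
have dvE : c = 2 * dotv v xi.
  have : dotv xi xi = 1 by [].
  have ee : dotv e e = 1.
    rewrite /dotv (bigD1 ord_max)//= big1 ?addr0 => [|k kn].
      by rewrite !mxE !eqxx mulr1.
    by rewrite !mxE (negbTE kn) andbF mulr0.
  move=> xx; have : dotv xi xi = dotv e e by rewrite xx ee.
  rewrite /c /dotv => /eqP; rewrite -subr_eq0 -sumrB => /eqP s0.
  rewrite mulr_sumr; apply/eqP; rewrite -subr_eq0 -sumrB.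
  rewrite -oppr_eq0 -sumrN -{2}s0; apply/eqP/eq_bigr => k _.
  by rewrite [v _ _]mxE [(- e) _ _]mxE; ring.
pose S : 'M[R]_n.+1 := (2 / c) *: (v^T *m v).
pose H : 'M[R]_n.+1 := 1%:M - S.
have HT : H^T = H.
  by rewrite /H /S linearB /= linearZ /= trmx_mul trmxK trmx1.
have xiH : xi *m H = e.
  rewrite /H mulmxBr mulmx1 -scalemxAr mulmxA dotE mul_scalar_mx scalerA.
  rewrite (_ : _ * _ = 1) ?scale1r ?subKr// mulrAC; apply: (mulIf v0).
  have -> : dotv xi v = dotv v xi by apply: eq_bigr => k _; rewrite mulrC.
  by rewrite divfK // mul1r [RHS]dvE.
have SS : S *m S = S + S.
  rewrite /S -scalemxAl -scalemxAr mulmxA -(mulmxA v^T) dotE -/c.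
  rewrite mul_mx_scalar -scalemxAl !scalerA -scalerDl.
  by congr (_ *: _); field.
have HH : H *m H = 1%:M.
  by rewrite mulmxBl mul1mx mulmxBr mulmx1 SS opprB addrK subrK.
by exists H; rewrite HT -xiH -mulmxA HH mulmx1.
Qed.

Section projections_and_isotropy.
Context (R : realType) (n : nat).
Implicit Types (x y xi theta : 'rV[R]_n) (K L D : set 'rV[R]_n) (l t : R).

(** The (n-1)-dimensional volume of the projection of [K] on [xi^perp], read in
    an orthonormal basis of [xi^perp]; Lebesgue measure being invariant under
    rotations, the basis selected by [xget] is immaterial. *)
Definition projection_function K xi : R :=
  let B := xget 0 (perp_frame xi) in
  volume [set y : 'rV[R]_n.-1 | proj_perp xi K (y *m B)].

Definition support_function K x : R := sup [set dotv x y | y in K].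

Definition projection_body_of K L :=
  [/\ convex_body L, origin_symmetric L &
   forall theta, sphere theta ->
     support_function L theta = projection_function K theta].

Definition projection_body L :=
  exists2 K, convex_body K & projection_body_of K L.

Definition isotropic_with K l :=
  [/\ volume K = 1, 0 < l & forall xi, sphere xi ->
   (\int[lebesgue_rV n]_(x in K) ((dotv x xi) ^+ 2)%:E = (l ^+ 2)%:E)%E].

Definition isotropic K := exists l, isotropic_with K l.

Definition dilate t K : set 'rV[R]_n := [set t *: x | x in K].

Definition dilate_of_isotropic D := exists2 t, 0 < t & isotropic (dilate t D).

(** [T \in unitmx] acts on row vectors on the right. The set below is a
    singleton when [K] is an origin-symmetric convex body. *)
Definition isotropic_constant K : R :=
  xget 0 [set l | exists2 T : 'M[R]_n, T \in unitmx &
                  isotropic_with [set x *m T | x in K] l].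

End projections_and_isotropy.

(* Main.v *)
(** Let [D = Pi M] be a projection body in [R^n].  The proof combines two facts.

    (1) If [P_K <= (1 + del) P_D] then [|K|^((n-1)/n) <= (1 + del) |D|^((n-1)/n)]
    (Petty, Schneider).  The body [D] is squeezed between a zonotope [Z], a sum
    of segments [[-v, v]], and a dilate of [D]; the volume of [K + s Z] is
    [|K| + 2 s sum_v |v| P_K(v / |v|) + O(s^2)], by iterating the identity
    [|K + [-v, v]| = |K| + 2 |v| P_K(v / |v|)], and it is at least
    [(|K|^(1/n) + s |D|^(1/n))^n] by the Brunn-Minkowski inequality.  To obtain
    [Z], replace [M] by a polytope [{x | max_i <x, a_i> <= 1}]: on every line of
    direction [xi] the function [max_i <x, a_i>] runs twice through
    [(1 - kap, 1]] with slopes [<xi, a_i>], so [2 kap P_M(xi)] is close to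
    [sum_i w_i |<xi, a_i>|], where [w_i] is the volume of the points at which the
    maximum lies in [(1 - kap, 1]] and is attained by [a_i].

    (2) If [E] is isotropic with constant [L], Chebyshev's inequality gives
    volume at least [3/4] to the part of [E] in the slab [|<x, xi>| <= 2 L], so
    [3/4 <= 4 L P_E(xi)].

    By (2), [P_K <= P_D + eps] implies the hypothesis of (1) with
    [del |D|^((n-1)/n) = (16/3) eps L_D], so the logarithmic factor is only
    bounded from below by [ln 2 ^ 2]. *)

Require Import Defs.
From HB Require Import structures.
From mathcomp Require Import all_boot all_order all_algebra.
From mathcomp Require Import all_classical all_reals all_analysis.
From mathcomp Require Import measurable_realfun ring lra.

Set Implicit Arguments.
Unset Strict Implicit.
Unset Printing Implicit Defensive.

Import Order.TTheory GRing.Theory Num.Theory.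
Import numFieldNormedType.Exports.

Local Open Scope classical_set_scope.
Local Open Scope ring_scope.

(** * Lebesgue measure on row vectors *)

(** Behind (1) stands Minkowski's first inequality for the mixed volume V(K, ..., K, D), usually
    combined with an integral formula for it in terms of P_K and the measure that generates the
    support function of D. No mixed volume and no surface area measure is defined here: D is
    replaced by a finite sum of segments Z, and n V(L, ..., L, Z) by a finite sum of the volumes
    gained when the segments are added. Derivatives at s = 0 become inequalities valid for every s >
    0, up to factors (1 + s c)^m that [ler_expr_limit] removes; the same lemma absorbs the error
    made in replacing D by Z.

    These sums are linear in the projection function, so they compare well under a factor 1 + del
    but not under an additive error. The lower bound (2) converts one into the other, and its
    dependence on |D| is exactly the power that appears in the conclusion.

    Lebesgue measure is built coordinate by coordinate, whereas every argument integrates along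
    lines of an arbitrary direction. Rotation invariance is therefore needed first; it is drawn from
    translation invariance, without determinants. *)

Lemma measurable_open_rV (R : realType) n (A : set 'rV[R]_n) :
  open A -> measurable A.
Proof.
move=> oA.
(* The sigma-algebra is generated by the coordinates, so an open set must be exhibited as a
   countable union of boxes; rational centres and half-sides suffice. *)
pose box (c : 'rV[rat]_n) (q : rat) : set 'rV[R]_n :=
  [set x | forall i, `|x ord0 i - ratr (c ord0 i)| < ratr q].
have mbox c q : measurable (box c q).
  rewrite (_ : box c q = \bigcap_(i in [set: 'I_n])
    ((fun x : 'rV[R]_n => x ord0 i : measurableTypeR R) @^-1`
       ball (ratr (c ord0 i) : R) (ratr q))).
    apply: fin_bigcap_measurable => // i _; rewrite -[X in measurable X]setTI.
    apply: measurable_coord_rV => //; exact: measurable_ball.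
  apply/seteqP; split=> [x xB i _|x xB i] /=.
    by rewrite /ball/= distrC; exact: xB.
  by have := xB i I; rewrite /= /ball/= distrC.
rewrite (_ : A = \bigcup_(p in [set: 'rV[rat]_n * rat])
   (if `[< box p.1 p.2 `<=` A >] then box p.1 p.2 else set0)).
  apply: countable_bigcupT_measurable => [|p]; first exact: countableP.
  by case: ifP => _; [exact: mbox|exact: measurable0].
apply/seteqP; split=> [x Ax|x [p _]]; last by case: asboolP => // pA; exact: pA.
have /nbhs_ballP[e /= e0 eA] : nbhs x A by apply: open_nbhs_nbhs; split.
have e2 : 0 < e / 2 by rewrite divr_gt0.
have [q /=] := rat_in_itvoo e2; rewrite in_itv/= => /andP[q0 qe].
have hc i : exists r : rat, `|x ord0 i - ratr r| < ratr q.
  have [r] := @rat_in_itvoo R (x ord0 i - ratr q) (x ord0 i + ratr q) ltac:(lra).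
  by rewrite in_itv/= => /andP[r1 r2]; exists r; rewrite ltr_norml; lra.
pose c : 'rV[rat]_n := \row_i xchoose (hc i).
exists (c, q) => //=; rewrite asboolT; first by move=> i; rewrite mxE; exact: (xchooseP (hc i)).
move=> y yb; apply: eA; split => //= i j; rewrite ord1 /ball/=.
have := yb j; rewrite mxE /= => y1; have x1 := xchooseP (hc j).
have -> : x ord0 j - y ord0 j = (x ord0 j - ratr (xchoose (hc j))) -
  (y ord0 j - ratr (xchoose (hc j))) by ring.
apply: (le_lt_trans (ler_normB _ _)); lra.
Qed.

Lemma measurable_closed_rV (R : realType) n (A : set 'rV[R]_n) :
  closed A -> measurable A.
Proof.
move=> cA; rewrite -[A]setCK; apply: measurableC; apply: measurable_open_rV.
exact: closed_openC.
Qed.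

Lemma measurable_compact_rV (R : realType) n (A : set 'rV[R]_n) :
  compact A -> measurable A.
Proof.
by move=> cA; apply: measurable_closed_rV; apply: compact_closed cA; exact: norm_hausdorff.
Qed.

Lemma measurable_mulmx (R : realType) n p (T : 'M[R]_(n, p)) :
  measurable_fun [set: 'rV[R]_n] (fun x => x *m T).
Proof.
apply: measurable_fun_rVP => j.
rewrite (_ : (fun _ => _) = (fun x : 'rV[R]_n => \sum_i x ord0 i * T i j)); last first.
  by apply/funext => x; rewrite mxE.
apply: measurable_sum => i; apply: measurable_funM => //.
exact: measurable_coord_rV.
Qed.

Lemma measurable_addrV (R : realType) n :
  measurable_fun [set: 'rV[R]_n * 'rV[R]_n] (fun p => p.1 + p.2).
Proof.
apply: measurable_fun_rVP => j.
rewrite (_ : (fun _ => _) = (fun p : 'rV[R]_n * 'rV[R]_n => p.1 ord0 j + p.2 ord0 j)); last first.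
  by apply/funext => x; rewrite mxE.
by apply: measurable_funD;
  (apply: (@measurableT_comp _ _ _ _ _ _ (fun x : 'rV[R]_n => x ord0 j : measurableTypeR R));
    [exact: measurable_coord_rV|]).
Qed.

Lemma measurable_scalerV (R : realType) n (a : R) :
  measurable_fun [set: 'rV[R]_n] (fun x => a *: x).
Proof.
rewrite (_ : (fun _ => _) = (fun x : 'rV[R]_n => x *m a%:M)); last first.
  by apply/funext => x; rewrite mul_mx_scalar.
exact: measurable_mulmx.
Qed.

(** The scaled pushforward [nu] agrees with Lebesgue measure on half-open intervals, and these
    determine it. *)
Lemma lebesgue_measure_affine (R : realType) (a b : R) (A : set (measurableTypeR R)) :
  0 < a -> measurable A ->
  lebesgue_measure A = (a%:E * lebesgue_measure ((fun t : R => (a * t + b)%R) @^-1` A))%E.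
Proof.
move=> a0 mA.
have mf : measurable_fun [set: measurableTypeR R] (fun t : R => a * t + b : measurableTypeR R).
  by apply: measurable_funD => //; exact: measurable_funM.
pose nu : {measure set (measurableTypeR R) -> \bar R} :=
  mscale (NngNum (ltW a0)) (measure_function_pushforward__canonical__measure_function_Measure
     (@lebesgue_measure R) mf).
have -> : lebesgue_measure A = nu A; last by [].
apply: lebesgue_measure_unique => // X /= [[x y] _ <-] /=.
rewrite /nu /mscale/= /pushforward/=.
rewrite (_ : _ @^-1` _ = `](x - b) / a, (y - b) / a]%classic); last first.
  apply/seteqP; split=> t /=; rewrite !in_itv/=.
    by rewrite ltr_pdivrMr// ler_pdivlMr// => /andP[? ?]; apply/andP; split; lra.
    by rewrite ltr_pdivrMr// ler_pdivlMr// => /andP[? ?]; apply/andP; split; lra.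
rewrite !lebesgue_measure_itv/= !lte_fin ltr_pM2r ?invr_gt0//.
rewrite [X in (if X then _ else _) = (_ * (if _ then _ else _))%E](_ : _ = (x - b < y - b)); last first.
  by apply/idP/idP; lra.
case: ifP => _; last by rewrite mule0.
by rewrite -!EFinB -EFinM; congr EFin; field; rewrite gt_eqF.
Qed.

Lemma lebesgue_measure_shift (R : realType) (b : R) (A : set (measurableTypeR R)) :
  measurable A ->
  lebesgue_measure ((fun t : R => (t + b)%R) @^-1` A) = lebesgue_measure A.
Proof.
move=> mA; rewrite (lebesgue_measure_affine b ltr01 mA) mul1e; congr lebesgue_measure.
by apply/funext => t /=; rewrite mul1r.
Qed.

(** Induction on the dimension: the translated product measure agrees with the product measure on
    rectangles, hence everywhere. *)
Lemma lebesgue_rV_shift (R : realType) n (v : 'rV[R]_n) (A : set 'rV[R]_n) :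
  measurable A -> lebesgue_rV n ((fun x => x + v) @^-1` A) = lebesgue_rV n A.
Proof.
elim: n v A => [|n IH] v A mA.
  by congr (lebesgue_rV _ _); apply/funext => x /=; rewrite (_ : x + v = x)//; apply/rowP => -[].
rewrite /= /lebesgue_rV_step /pushforward.
set B := cons_rV (n:=n) @^-1` A.
have mB : measurable B by rewrite -[B]setTI; exact: measurable_cons_rV.
pose v1 := (uncons_rV v).1; pose v2 := (uncons_rV v).2.
pose sh (p : measurableTypeR R * 'rV[R]_n) : measurableTypeR R * 'rV[R]_n := ((p.1 + v1)%R, (p.2 + v2)%R).
have msh1 : measurable_fun [set: measurableTypeR R] (fun t : R => t + v1 : measurableTypeR R).
  exact: measurable_funD.
have msh2 : measurable_fun [set: 'rV[R]_n] (fun t => t + v2).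
  rewrite (_ : (fun _ => _) = (fun p => p.1 + p.2) \o (fun x : 'rV[R]_n => (x, v2))); last by [].
  by apply: measurableT_comp; [exact: measurable_addrV|exact: measurable_fun_pair].
have msh : measurable_fun setT sh.
  apply/measurable_fun_pair.
    by apply: (measurableT_comp msh1); exact: measurable_fst.
  by apply: (measurableT_comp msh2); exact: measurable_snd.
rewrite (_ : _ @^-1` _ = sh @^-1` B); last first.
  apply/funext => p; rewrite /B /sh /=; congr A.
  apply/rowP => i; rewrite mxE; have [j ->|->] := unliftP ord0 i.
    by rewrite !cons_rVS/= mxE /v2 /= mxE.
  by rewrite !cons_rV0.
pose nu : {measure set (measurableTypeR R * 'rV[R]_n) -> \bar R} :=
  measure_function_pushforward__canonical__measure_function_Measure
     (lebesgue_measure \x lebesgue_rV n)%E msh.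
suff /(_ _ mB) : forall X, measurable X -> (lebesgue_measure \x lebesgue_rV n)%E X = nu X by move=> ->.
apply: product_measure_unique => A1 A2 mA1 mA2; rewrite /nu /= /pushforward.
rewrite (_ : _ @^-1` _ = ((fun t : R => t + v1) @^-1` A1) `*` ((fun x => x + v2) @^-1` A2))//.
rewrite product_measure1E//=.
- by rewrite lebesgue_measure_shift// IH.
- by rewrite -[X in measurable X]setTI; exact: msh1.
- by rewrite -[X in measurable X]setTI; exact: msh2.
Qed.

(** Tonelli's theorem for an indicator, from the uniqueness of the product measure. *)
Lemma integral_xsection_ysection d1 d2 (T1 : measurableType d1)
    (T2 : measurableType d2) (R : realType)
    (m1 : {sigma_finite_measure set T1 -> \bar R})
    (m2 : {sigma_finite_measure set T2 -> \bar R}) (A : set (T1 * T2)) :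
  measurable A ->
  (\int[m1]_x m2 (xsection A x) = \int[m2]_y m1 (ysection A y))%E.
Proof.
move=> mA.
have E : forall X, measurable X -> (m1 \x m2)%E X = (m1 \x^ m2)%E X.
  by apply: product_measure_unique => A1 A2 mA1 mA2; exact: product_measure2E.
exact: E.
Qed.

(** Uniqueness of translation-invariant measures: substitute [y + x *m T] for
    [y], then [x - y *m invmx T] for [x], in the double integral of
    [1_A(x *m T) 1_B(y)]. *)
Lemma lebesgue_rV_mulmx_opp (R : realType) n (T : 'M[R]_n) (A B : set 'rV[R]_n) :
  T \in unitmx -> measurable A -> measurable B ->
  (lebesgue_rV n [set x | A (x *m T)] * lebesgue_rV n B =
   lebesgue_rV n [set x | B (x *m T)] * lebesgue_rV n [set x | A (- x)%R])%E.
Proof.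
move=> uT mA mB.
have mT : measurable_fun [set: 'rV[R]_n] (fun x => x *m T) := measurable_mulmx T.
have mpre (C : set 'rV[R]_n) : measurable C -> measurable [set x | C (x *m T)].
  by move=> mC; rewrite -[X in measurable X]setTI; exact: mT.
have mopp : measurable_fun [set: 'rV[R]_n] (fun x => - x).
  rewrite (_ : (fun _ => _) = (fun x : 'rV[R]_n => (-1) *: x)); first exact: measurable_scalerV.
  by apply/funext => x; rewrite scaleN1r.
have mfst : measurable_fun [set: 'rV[R]_n * 'rV[R]_n] (fun p => p.1 *m T).
  by apply: (measurableT_comp mT); exact: measurable_fst.
pose W := [set p : 'rV[R]_n * 'rV[R]_n | A (p.1 *m T) /\ B (p.2 + p.1 *m T)].
pose W' := [set p : 'rV[R]_n * 'rV[R]_n | A (p.1 *m T - p.2) /\ B (p.1 *m T)].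
have mW : measurable W.
  apply: measurableI.
    by rewrite -[X in measurable X]setTI; exact: mfst.
  rewrite -[X in measurable X]setTI.
  apply: (measurableT_comp (measurable_addrV (R:=R) (n:=n)) (g:=fun p : 'rV[R]_n * 'rV[R]_n => (p.2, p.1 *m T))) => //.
  by apply: measurable_fun_pair => //; exact: measurable_snd.
have mW' : measurable W'.
  apply: measurableI; last first.
    by rewrite -[X in measurable X]setTI; exact: mfst.
  rewrite -[X in measurable X]setTI.
  apply: (measurableT_comp (measurable_addrV (R:=R) (n:=n)) (g:=fun p : 'rV[R]_n * 'rV[R]_n => (p.1 *m T, - p.2))) => //.
  apply: measurable_fun_pair => //; apply: (measurableT_comp mopp); exact: measurable_snd.
pose l := lebesgue_rV (R:=R) n.
transitivity (\int[l]_x l (xsection W x))%E.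
  rewrite (eq_integral (fun x => (\1_[set x | A (x *m T)] x)%:E * l B)%E); last first.
    move=> x _; rewrite indicE; case: (boolP (x \in _)) => [|]; rewrite ?inE ?notin_setE/= => Ax.
      rewrite mul1e -(lebesgue_rV_shift (x *m T) mB); congr (lebesgue_rV _ _).
      by apply/seteqP; split=> y; rewrite /xsection /= inE /W /=; [case|].
    rewrite mul0e (_ : xsection _ _ = set0) ?measure0//.
    by apply/seteqP; split=> y; rewrite /xsection /= ?inE /W /=; [case|].
  rewrite ge0_integralZr ?integral_indic ?setIT//; last first.
    by apply/measurable_EFinP; apply: measurable_indic; exact: mpre.
  exact: mpre.
rewrite integral_xsection_ysection//.
transitivity (\int[l]_x l (xsection W' x))%E; last first.
  rewrite (eq_integral (fun x => (\1_[set x | B (x *m T)] x)%:E * l [set x | A (- x)%R])%E); last first.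
    move=> x _; rewrite indicE; case: (boolP (x \in _)) => [|]; rewrite ?inE ?notin_setE/= => Bx.
      rewrite mul1e -(@lebesgue_rV_shift _ _ (- (x *m T)) [set x | A (- x)%R]); last first.
        by rewrite -[X in measurable X]setTI; exact: mopp.
      congr (lebesgue_rV _ _).
      apply/seteqP; split=> y; rewrite /xsection /= inE /W' /=; first by case; rewrite opprD opprK addrC.
      by rewrite opprD opprK addrC.
    rewrite mul0e (_ : xsection _ _ = set0) ?measure0//.
    by apply/seteqP; split=> y; rewrite /xsection /= ?inE /W' /=; [case|].
  rewrite ge0_integralZr ?integral_indic ?setIT//; last 2 first.
    exact: mpre.
    by apply/measurable_EFinP; apply: measurable_indic; exact: mpre.
rewrite integral_xsection_ysection//; apply: eq_integral => y _.
rewrite -(@lebesgue_rV_shift _ _ (- (y *m invmx T)) (ysection W y)); last exact: measurable_ysection.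
congr (lebesgue_rV _ _); apply/seteqP; split=> x; rewrite /ysection /= !inE /W /W' /=.
  by rewrite mulmxBl mulmxKV// [y + _]addrC subrK.
by rewrite mulmxBl mulmxKV// [y + _]addrC subrK.
Qed.

(** Closed balls of the sup norm. Their volume is explicit, so they serve as test sets in changes of
    variables; half-side 1/2 gives volume 1. *)
Definition cube (R : realType) n (c : 'rV[R]_n) (r : R) : set 'rV[R]_n :=
  [set x | forall i, `|x ord0 i - c ord0 i| <= r].

Lemma lebesgue_rV_cube (R : realType) n (c : 'rV[R]_n) (r : R) : 0 < r ->
  lebesgue_rV n (cube c r) = ((2 * r) ^+ n)%:E.
Proof.
move=> r0.
pose A i : set (measurableTypeR R) := `[c ord0 i - r, c ord0 i + r]%classic.
rewrite (_ : cube c r = [set x : 'rV[R]_n | forall i, A i (x ord0 i)]); last first.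
  by apply/seteqP; split=> x /= H i; have := H i; rewrite /A /= in_itv/= ler_norml => /andP[? ?]; apply/andP; split; lra.
rewrite lebesgue_rV_box => [|i]; last exact: measurable_itv.
rewrite (eq_bigr (fun=> (2 * r)%:E)) => [|i _].
  by rewrite prodEFin prodr_const card_ord.
rewrite /A lebesgue_measure_itv/= lte_fin ifT; last by lra.
by rewrite -EFinB; congr EFin; ring.
Qed.

Lemma measurable_cube (R : realType) n (c : 'rV[R]_n) (r : R) : measurable (cube c r).
Proof.
rewrite (_ : cube c r = \bigcap_(i in [set: 'I_n])
    ((fun x : 'rV[R]_n => x ord0 i : measurableTypeR R) @^-1`
       `[c ord0 i - r, c ord0 i + r]%classic)).
  apply: fin_bigcap_measurable => // i _; rewrite -[X in measurable X]setTI.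
  by apply: measurable_coord_rV => //; exact: measurable_itv.
apply/seteqP; split=> [x H i _|x H i] /=.
  by have := H i; rewrite in_itv/= ler_norml => /andP[? ?]; apply/andP; split; lra.
by have := H i I; rewrite /= in_itv/= ler_norml => /andP[? ?]; apply/andP; split; lra.
Qed.

Lemma dotvC (R : realType) n (x y : 'rV[R]_n) : dotv x y = dotv y x.
Proof. by apply: eq_bigr => i _; rewrite mulrC. Qed.

Lemma dotvDl (R : realType) n (x y z : 'rV[R]_n) : dotv (x + y) z = dotv x z + dotv y z.
Proof. by rewrite -big_split; apply: eq_bigr => i _; rewrite mxE mulrDl. Qed.

Lemma dotvZl (R : realType) n a (x y : 'rV[R]_n) : dotv (a *: x) y = a * dotv x y.
Proof. by rewrite /dotv mulr_sumr; apply: eq_bigr => i _; rewrite mxE mulrA. Qed.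

Lemma dotvDr (R : realType) n (x y z : 'rV[R]_n) : dotv z (x + y) = dotv z x + dotv z y.
Proof. by rewrite dotvC dotvDl !(dotvC z). Qed.

Lemma dotvZr (R : realType) n a (x y : 'rV[R]_n) : dotv y (a *: x) = a * dotv y x.
Proof. by rewrite dotvC dotvZl dotvC. Qed.

Lemma dotvNl (R : realType) n (x y : 'rV[R]_n) : dotv (- x) y = - dotv x y.
Proof. by rewrite -scaleN1r dotvZl mulN1r. Qed.

Lemma dotvNr (R : realType) n (x y : 'rV[R]_n) : dotv y (- x) = - dotv y x.
Proof. by rewrite -scaleN1r dotvZr mulN1r. Qed.

Lemma dot0v (R : realType) n (x : 'rV[R]_n) : dotv 0 x = 0.
Proof. by rewrite -(scale0r x) dotvZl mul0r. Qed.

Lemma dotv0 (R : realType) n (x : 'rV[R]_n) : dotv x 0 = 0.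
Proof. by rewrite dotvC dot0v. Qed.

Lemma dotv_ge0 (R : realType) n (x : 'rV[R]_n) : 0 <= dotv x x.
Proof. by apply: sumr_ge0 => i _; exact: sqr_ge0. Qed.

Lemma dotv_eq0 (R : realType) n (x : 'rV[R]_n) : (dotv x x == 0) = (x == 0).
Proof.
apply/eqP/eqP => [/eqP|->]; last by rewrite dotv0.
rewrite psumr_eq0 => [/allP x0|i _]; last exact: sqr_ge0.
apply/rowP => i; have := x0 i; rewrite mem_index_enum => /(_ isT).
by rewrite mulf_eq0 orbb mxE => /eqP.
Qed.

Lemma dotvE (R : realType) n (x y : 'rV[R]_n) : x *m y^T = (dotv x y)%:M.
Proof.
apply/matrixP => i j; rewrite !ord1 !mxE mulr1n.
by apply: eq_bigr => k _; rewrite mxE.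
Qed.

Lemma dotv_mulmx (R : realType) n p (T : 'M[R]_(n, p)) (x : 'rV[R]_n) (y : 'rV[R]_p) :
  dotv (x *m T) y = dotv x (y *m T^T).
Proof.
have := congr1 (fun M : 'M[R]_1 => M ord0 ord0) (dotvE (x *m T) y).
have := congr1 (fun M : 'M[R]_1 => M ord0 ord0) (dotvE x (y *m T^T)).
by rewrite trmx_mul trmxK mulmxA => ->; rewrite !mxE eqxx !mulr1n => ->.
Qed.

Lemma measurable_dotv (R : realType) n (v : 'rV[R]_n) :
  measurable_fun [set: 'rV[R]_n] (fun x => dotv x v).
Proof.
apply: measurable_sum => i; apply: measurable_funM => //.
exact: measurable_coord_rV.
Qed.

Lemma cube_sub_ball (R : realType) n (c : 'rV[R]_n) (r e : R) :
  0 < r -> r < e -> cube c r `<=` ball c e.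
Proof.
move=> r0 re x xc; split => [|i j]; first exact: lt_trans re.
by rewrite ord1 /ball/= distrC; exact: le_lt_trans (xc j) re.
Qed.

Lemma lebesgue_rV_open_gt0 (R : realType) n (A : set 'rV[R]_n) :
  measurable A -> A° !=set0 -> (0 < lebesgue_rV n A)%E.
Proof.
move=> mA [c] /nbhs_ballP[e /= e0 cA].
have e2 : 0 < e / 2 by rewrite divr_gt0.
apply: (@lt_le_trans _ _ (lebesgue_rV n (cube c (e / 2)))).
  by rewrite lebesgue_rV_cube// lte_fin exprn_gt0// mulr_gt0.
apply: le_measure; rewrite ?inE//; first exact: measurable_cube.
by apply: subset_trans cA; apply: cube_sub_ball => //; lra.
Qed.

Lemma bounded_sub_cube (R : realType) n (A : set 'rV[R]_n) :
  bounded_set A -> exists2 r, 0 < r & A `<=` cube 0 r.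
Proof.
move=> [M [_ AM]]; exists (`|M| + 1); first by rewrite ltr_wpDl.
move=> x Ax i; rewrite mxE subr0; have := AM (`|M| + 1); rewrite ltr_pwDr// ?ler_norm//.
move=> /(_ isT x Ax) /=; apply: le_trans; rewrite [`|x|]mx_normrE.
exact: (le_bigmax _ (fun ij : 'I_1 * 'I_n => `|x ij.1 ij.2|) (ord0, i)).
Qed.

Lemma lebesgue_rV_bounded (R : realType) n (A : set 'rV[R]_n) :
  measurable A -> bounded_set A -> (lebesgue_rV n A < +oo)%E.
Proof.
move=> mA /bounded_sub_cube[r r0 Ar].
apply: (@le_lt_trans _ _ (lebesgue_rV n (cube 0 r))).
  by apply: le_measure; rewrite ?inE//; exact: measurable_cube.
by rewrite lebesgue_rV_cube// ltry.
Qed.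

Lemma lebesgue_rV_compact (R : realType) n (A : set 'rV[R]_n) :
  compact A -> lebesgue_rV n A = (volume A)%:E.
Proof.
move=> cA; rewrite /volume fineK// ge0_fin_numE// lebesgue_rV_bounded//.
  exact: measurable_compact_rV.
exact: compact_bounded.
Qed.

(** With the identity matrix and a cube of volume 1, only the reflection is left in
    [lebesgue_rV_mulmx_opp]. *)
Lemma lebesgue_rV_opp (R : realType) n (A : set 'rV[R]_n) :
  measurable A -> lebesgue_rV n [set x | A (- x)] = lebesgue_rV n A.
Proof.
move=> mA.
have := @lebesgue_rV_mulmx_opp R n 1%:M A (cube 0 (2^-1)) (unitmx1 _ _) mA (measurable_cube _ _).
rewrite (_ : [set x | cube 0 _ _] = cube 0 2^-1); last first.
  by apply/funext => x /=; rewrite mulmx1.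
rewrite (_ : [set x | A _] = A); last by apply/funext => x /=; rewrite mulmx1.
by rewrite lebesgue_rV_cube// divff// expr1n mule1 mul1e => ->.
Qed.

(** A linear map multiplies all volumes by the same factor. This stands in for the determinant: each
    use computes the factor on a convenient test set. *)
Lemma lebesgue_rV_mulmx (R : realType) n (T : 'M[R]_n) (A B : set 'rV[R]_n) :
  T \in unitmx -> measurable A -> measurable B ->
  (lebesgue_rV n [set x | A (x *m T)] * lebesgue_rV n B =
   lebesgue_rV n [set x | B (x *m T)] * lebesgue_rV n A)%E.
Proof. by move=> uT mA mB; rewrite lebesgue_rV_mulmx_opp// lebesgue_rV_opp. Qed.

Lemma lebesgue_rV_scale (R : realType) n (a : R) (A : set 'rV[R]_n) :
  0 < a -> measurable A ->
  lebesgue_rV n [set x | A (a^-1 *: x)] = ((a ^+ n)%:E * lebesgue_rV n A)%E.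
Proof.
move=> a0 mA.
have uT : a^-1%:M \in @unitmx R n.
  by rewrite unitmxE det_scalar unitfE expf_neq0// invr_eq0 gt_eqF.
have := lebesgue_rV_mulmx uT mA (measurable_cube 0 2^-1).
rewrite (_ : [set x | cube 0 _ _] = cube 0 (a / 2)); last first.
  apply/seteqP; split=> x /= H i; have := H i; rewrite ?mul_mx_scalar !mxE ?subr0 normrM normfV (gtr0_norm a0).
    by rewrite [a^-1 * _]mulrC ler_pdivrMr// [2^-1 * a]mulrC.
  by rewrite [a^-1 * _]mulrC ler_pdivrMr// [2^-1 * a]mulrC.
rewrite (_ : [set x | A _] = [set x | A (a^-1 *: x)]); last first.
  by apply/funext => x /=; rewrite mul_mx_scalar.
rewrite !lebesgue_rV_cube ?divr_gt0// divff// expr1n mule1 => ->.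
by rewrite mulrC divfK.
Qed.

Lemma lebesgue_rV_orthogonal (R : realType) n (T : 'M[R]_n) (A : set 'rV[R]_n) :
  T *m T^T = 1%:M -> measurable A ->
  lebesgue_rV n [set x | A (x *m T)] = lebesgue_rV n A.
Proof.
move=> TT mA.
have uT : T \in unitmx by have [] := mulmx1_unit TT.
(* The Euclidean ball is its own preimage under an orthogonal matrix, so the factor is 1 once its
   volume is known to be positive and finite. *)
pose B : set 'rV[R]_n := [set x | dotv x x <= 1].
have mB : measurable B.
  rewrite -[B]setTI.
  have mf : measurable_fun [set: 'rV[R]_n] (fun x => dotv x x : measurableTypeR R).
    by apply: measurable_sum => i; apply: measurable_funM; exact: measurable_coord_rV.
  rewrite (_ : B = (fun x => dotv x x) @^-1` `]-oo, 1]%classic).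
    by apply: mf => //; exact: measurable_itv.
  by apply/seteqP; split=> x /=; rewrite in_itv.
have := lebesgue_rV_mulmx uT mA mB.
rewrite (_ : [set x | B _] = B); last first.
  by apply/funext => x; rewrite /B /= dotv_mulmx -mulmxA TT mulmx1.
have B1 : B `<=` cube 0 1.
  move=> x Bx i; rewrite mxE subr0 -(@ler_pXn2r _ 2)// ?nnegrE// expr1n.
  apply: le_trans Bx; rewrite /dotv (bigD1 i)//= real_normK ?num_real// expr2 lerDl.
  by apply: sumr_ge0 => j _; exact: sqr_ge0.
have Bfin : (lebesgue_rV n B < +oo)%E.
  apply: (@le_lt_trans _ _ (lebesgue_rV n (cube 0 1))).
    by apply: le_measure; rewrite ?inE//; exact: measurable_cube.
  by rewrite lebesgue_rV_cube// ltry.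
have Bpos : (0 < lebesgue_rV n B)%E.
  (* A cube inside the ball: each of the [n] squares is at most [r ^+ 2 <= r]. The successor covers
     [n = 0]. *)
  pose r : R := n.+1%:R^-1.
  have r0 : 0 < r by rewrite invr_gt0.
  apply: (@lt_le_trans _ _ (lebesgue_rV n (cube 0 r))).
    by rewrite lebesgue_rV_cube// lte_fin exprn_gt0// mulr_gt0.
  apply: le_measure; rewrite ?inE//; first exact: measurable_cube.
  move=> x xr; rewrite /B /= /dotv.
  apply: (@le_trans _ _ (\sum_(i < n) r)).
    apply: ler_sum => i _; have := xr i; rewrite mxE subr0 => xir.
    rewrite -expr2 -real_normK ?num_real//; apply: (@le_trans _ _ (r ^+ 2)).
      by rewrite ler_pXn2r ?nnegrE// ltW.
    by rewrite expr2 ler_piMl ?(ltW r0)// /r invf_le1// ler1n.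
  rewrite sumr_const card_ord -mulr_natl ler_pdivrMr// mul1r ler_nat.
  exact: leqW.
rewrite [RHS]muleC => H; have Bf : lebesgue_rV n B \is a fin_num by rewrite ge0_fin_numE.
by apply/eqP; rewrite eq_le -(lee_pmul2r Bf Bpos) -[X in _ && X](lee_pmul2r Bf Bpos) H !lexx.
Qed.

Section perp_coordinates.
Context (R : realType) (m : nat) (xi : 'rV[R]_m.+1) (B : 'M[R]_(m, m.+1)).
Hypotheses (xi1 : sphere xi) (BF : perp_frame (n:=m.+1) xi B).

(** The orthogonal matrix with rows [xi] and then those of [B]. It turns the splitting off of the
    first coordinate, built into [lebesgue_rV], into a splitting along [xi]. *)
Let O : 'M[R]_m.+1 :=
  \matrix_(i, j) oapp (B ^~ j) (xi ord0 j) (unlift ord0 i).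

Let consO p : cons_rV p *m O = p.1 *: xi + p.2 *m B.
Proof.
apply/rowP => j; rewrite !mxE big_ord_recl cons_rV0 mxE unlift_none/=; congr (_ + _).
by apply: eq_bigr => k _; rewrite cons_rVS mxE liftK.
Qed.

Let OO : O *m O^T = 1%:M.
Proof.
have [BB Bxi] := BF.
have xiB k : \sum_j B k j * xi ord0 j = 0.
  have := congr1 (fun M : 'cV[R]_m => M k ord0) Bxi; rewrite !mxE => H; rewrite -[RHS]H.
  by apply: eq_bigr => j _; rewrite mxE.
apply/matrixP => i k; rewrite !mxE.
have [i' ->|->] := unliftP ord0 i; have [k' ->|->] := unliftP ord0 k.
- have := congr1 (fun M : 'M[R]_m => M i' k') BB; rewrite !mxE (inj_eq (@lift_inj _ _)) => <-.
  by apply: eq_bigr => j _; rewrite !mxE !liftK.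
- rewrite eq_sym (negbTE (neq_lift _ _)) -[RHS](xiB i').
  by apply: eq_bigr => j _; rewrite !mxE !liftK unlift_none.
- rewrite (negbTE (neq_lift _ _)) -[RHS](xiB k').
  by apply: eq_bigr => j _; rewrite !mxE !liftK unlift_none mulrC.
- rewrite eqxx -[RHS]xi1.
  by apply: eq_bigr => j _; rewrite !mxE unlift_none.
Qed.

Let measurable_param (A : set 'rV[R]_m.+1) : measurable A ->
  measurable [set p : measurableTypeR R * 'rV[R]_m | A (p.1 *: xi + p.2 *m B)].
Proof.
move=> mA; rewrite -[X in measurable X]setTI.
rewrite (_ : [set p | _] = (fun p => cons_rV p *m O) @^-1` A); last first.
  by apply/funext => p; rewrite /preimage/= consO.
apply: (measurableT_comp (measurable_mulmx O)) => //; exact: measurable_cons_rV.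
Qed.

Definition line_measure (A : set 'rV[R]_m.+1) (y : 'rV[R]_m) : \bar R :=
  lebesgue_measure [set t : R | A (t *: xi + y *m B)].

Let ysectionE (A : set 'rV[R]_m.+1) (y : 'rV[R]_m) :
  ysection [set p : measurableTypeR R * 'rV[R]_m | A (p.1 *: xi + p.2 *m B)] y =
  [set t : R | A (t *: xi + y *m B)].
Proof. by apply/seteqP; split=> t; rewrite /ysection/= inE. Qed.

Lemma measurable_line (A : set 'rV[R]_m.+1) y : measurable A ->
  measurable [set t : measurableTypeR R | A (t *: xi + y *m B)].
Proof. by move=> /measurable_param mA; rewrite -ysectionE; exact: measurable_ysection. Qed.

Lemma measurable_line_measure (A : set 'rV[R]_m.+1) : measurable A ->
  measurable_fun [set: 'rV[R]_m] (line_measure A).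
Proof.
move=> /measurable_param/(measurable_fun_ysection lebesgue_measure).
by congr measurable_fun; apply/funext => y; rewrite /= ysectionE.
Qed.

Lemma lebesgue_rV_fubini (A : set 'rV[R]_m.+1) : measurable A ->
  lebesgue_rV m.+1 A = (\int[lebesgue_rV m]_y line_measure A y)%E.
Proof.
move=> mA; rewrite -(lebesgue_rV_orthogonal OO mA).
rewrite [LHS]/= /lebesgue_rV_step /pushforward /product_measure1.
rewrite (_ : _ @^-1` _ = [set p | A (p.1 *: xi + p.2 *m B)]); last first.
  by apply/funext => p; rewrite /preimage/= consO.
rewrite integral_xsection_ysection; last exact: measurable_param.
by apply: eq_integral => y _; rewrite ysectionE.
Qed.

End perp_coordinates.

(** * Volumes of projections *)

Lemma convex_setP (R : realType) n (K : set 'rV[R]_n) :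
  convex_set K <->
  (forall x y t, 0 <= t -> t <= 1 -> K x -> K y -> K (t *: x + (1 - t) *: y)).
Proof.
split=> [cK x y t t0 t1 Kx Ky|cK x y l].
  have := cK x y (Itv01 t0 t1); rewrite !inE => /(_ Kx Ky).
  by rewrite /conv /=.
rewrite !inE => Kx Ky; have := cK x y l%:num; rewrite ge0 le1 => /(_ isT isT Kx Ky).
by rewrite /conv /=.
Qed.

Lemma continuous_rV (R : realType) (T : topologicalType) n (f : T -> 'rV[R]_n) :
  (forall i, continuous (fun x => f x ord0 i)) -> continuous f.
Proof.
move=> cf x; apply/cvgrPdist_le => /= e e0.
near=> y.
rewrite [leLHS]/Num.Def.normr/= mx_normrE (bigmax_le _ (ltW e0))//= => -[i j] _.
rewrite !mxE/= ord1; move: j; near: y; apply: filter_forall => /= j.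
by have := cf j x; move=> /cvgrPdist_le; apply.
Unshelve. all: by end_near. Qed.

Lemma continuous_sum (R : realType) (T : topologicalType) (I : Type) (s : seq I)
    (f : I -> T -> R) :
  (forall i, continuous (f i)) -> continuous (fun x => \sum_(i <- s) f i x).
Proof.
move=> cf x; elim: s => [|i s IH].
  rewrite (_ : (fun _ => _) = fun=> 0); first exact: cvg_cst.
  by apply/funext => y; rewrite big_nil.
rewrite (_ : (fun _ => _) = fun y => f i y + \sum_(i <- s) f i y); last first.
  by apply/funext => y; rewrite big_cons.
by apply: cvgD IH; exact: cf.
Qed.

Lemma continuous_dotv (R : realType) n (v : 'rV[R]_n) : continuous (fun x => dotv x v).
Proof.
apply: continuous_sum => i x; apply: continuousM; last exact: cst_continuous.
exact: coord_continuous.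
Qed.

Lemma continuous_dotvv (R : realType) n : continuous (fun x : 'rV[R]_n => dotv x x).
Proof. by apply: continuous_sum => i x; apply: continuousM; exact: coord_continuous. Qed.

Lemma continuous_mulmx (R : realType) n p (T : 'M[R]_(n, p)) :
  continuous (fun x : 'rV[R]_n => x *m T).
Proof.
apply: continuous_rV => j.
rewrite (_ : (fun _ => _) = (fun x : 'rV[R]_n => \sum_i x ord0 i * T i j)); last first.
  by apply/funext => x; rewrite mxE.
apply: continuous_sum => i x; apply: continuousM; last exact: cst_continuous.
exact: coord_continuous.
Qed.

Definition minkowski_sum (R : realType) n (A B : set 'rV[R]_n) : set 'rV[R]_n :=
  [set x + y | x in A & y in B].

Lemma compact_image_rV (R : realType) n p (f : 'rV[R]_n -> 'rV[R]_p) (A : set 'rV[R]_n) :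
  continuous f -> compact A -> compact (f @` A).
Proof. by move=> cf; apply: continuous_compact; apply: continuous_subspaceT. Qed.

Lemma compact_minkowski_sum (R : realType) n (A B : set 'rV[R]_n) :
  compact A -> compact B -> compact (minkowski_sum A B).
Proof.
move=> cA cB.
rewrite (_ : minkowski_sum A B = (fun p : 'rV[R]_n * 'rV[R]_n => p.1 + p.2) @` (A `*` B)).
  apply: continuous_compact; last exact: compact_setX.
  by apply: continuous_subspaceT; exact: add_continuous.
apply/seteqP; split=> x /=.
  by move=> [a Aa [b Bb <-]]; exists (a, b).
by move=> [[a b] [/= Aa Bb] <-]; exists a => //; exists b.
Qed.

Lemma compact_dilate (R : realType) n (a : R) (A : set 'rV[R]_n) :
  compact A -> compact (dilate a A).
Proof.
rewrite (_ : dilate a A = (fun x => x *m a%:M) @` A).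
  by apply: compact_image_rV; exact: continuous_mulmx.
by congr image; apply/funext => x; rewrite mul_mx_scalar.
Qed.

Lemma dilateE (R : realType) n (a : R) (A : set 'rV[R]_n) :
  a != 0 -> dilate a A = [set x | A (a^-1 *: x)].
Proof.
move=> a0; apply/seteqP; split=> x /=; first by move=> [y Ay <-]; rewrite scalerK.
by move=> Ax; exists (a^-1 *: x) => //; rewrite scalerKV.
Qed.

Lemma lebesgue_rV_dilate (R : realType) n (a : R) (A : set 'rV[R]_n) :
  0 < a -> measurable A ->
  lebesgue_rV n (dilate a A) = ((a ^+ n)%:E * lebesgue_rV n A)%E.
Proof. by move=> a0 mA; rewrite dilateE ?gt_eqF// lebesgue_rV_scale. Qed.

Lemma volume_dilate (R : realType) n (a : R) (A : set 'rV[R]_n) :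
  0 < a -> compact A -> volume (dilate a A) = a ^+ n * volume A.
Proof.
move=> a0 cA; rewrite {1}/volume lebesgue_rV_dilate//; last exact: measurable_compact_rV.
by rewrite lebesgue_rV_compact.
Qed.

Lemma le_volume (R : realType) n (A B : set 'rV[R]_n) :
  compact A -> compact B -> A `<=` B -> volume A <= volume B.
Proof.
move=> cA cB AB; rewrite -lee_fin -!lebesgue_rV_compact//.
by apply: le_measure; rewrite ?inE//; exact: measurable_compact_rV.
Qed.

Lemma volume_ge0 (R : realType) n (A : set 'rV[R]_n) : 0 <= volume A.
Proof. by apply: fine_ge0; exact: measure_ge0. Qed.

Lemma volume_gt0 (R : realType) n (A : set 'rV[R]_n) : convex_body A -> 0 < volume A.
Proof.
move=> [cA _ iA]; rewrite -lte_fin -lebesgue_rV_compact//.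
by apply: lebesgue_rV_open_gt0 => //; exact: measurable_compact_rV.
Qed.

Section shadow.
Context (R : realType) (m : nat) (xi : 'rV[R]_m.+1).
Hypothesis xi1 : sphere xi.
Implicit Types K L : set 'rV[R]_m.+1.

Definition frame : 'M[R]_(m, m.+1) := xget 0 (perp_frame (n:=m.+1) xi).

Lemma frameP : perp_frame (n:=m.+1) xi frame.
Proof. by have [B BF] := perp_frame_nonempty (ltn0Sn m) xi1; exact: (xgetPex 0 (ex_intro _ B BF)). Qed.

(** The projection of [K] in the coordinates of [frame], described by fibres as Fubini requires;
    [shadow_image] describes it as a linear image, which gives compactness. *)
Definition shadow K : set 'rV[R]_m := [set y | exists t, K (t *: xi + y *m frame)].

Lemma dotv_frame y : dotv (y *m frame) xi = 0.
Proof.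
have [_ Bxi] := frameP.
by rewrite dotv_mulmx -[_ *m _]trmxK trmx_mul trmxK Bxi trmx0 dotv0.
Qed.

Lemma projection_functionE K : projection_function K xi = volume (shadow K).
Proof.
rewrite /projection_function -/frame; congr volume; apply/seteqP; split=> y /=.
  by move=> [x Kx xE]; exists (dotv x xi); rewrite -xE addrC subrK.
move=> [t Kt]; exists (t *: xi + y *m frame) => //.
by rewrite dotvDl dotvZl dotv_frame xi1 addr0 mulr1 addrC addKr.
Qed.

Lemma frame_coord t y : (t *: xi + y *m frame) *m frame^T = y.
Proof.
have [BB Bxi] := frameP.
rewrite mulmxDl -scalemxAl -mulmxA BB mulmx1.
by rewrite -[xi *m _]trmxK trmx_mul trmxK Bxi trmx0 scaler0 add0r.
Qed.

Lemma frame_complete x : x = dotv x xi *: xi + (x *m frame^T) *m frame.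
Proof.
pose M : 'M[R]_(1 + m) := col_mx xi frame.
have [BB Bxi] := frameP.
have MM : M *m M^T = 1%:M.
  rewrite /M tr_col_mx mul_col_row BB Bxi.
  rewrite (_ : xi *m frame^T = 0); last by rewrite -[LHS]trmxK trmx_mul trmxK Bxi trmx0.
  rewrite dotvE (xi1 : dotv xi xi = 1); exact/esym/scalar_mx_block.
(* A square matrix with orthonormal rows also has orthonormal columns; this is the expansion of [x]
   in the basis. *)
have /(congr1 (mulmx x)) := mulmx1C MM.
rewrite /M tr_col_mx mul_row_col mulmx1 mulmxDr !mulmxA dotvE mul_scalar_mx => H.
by rewrite -[LHS]H.
Qed.

Lemma shadow_image K : shadow K = (fun x => x *m frame^T) @` K.
Proof.
apply/seteqP; split=> y /=.
  by move=> [t Kt]; exists (t *: xi + y *m frame) => //; rewrite frame_coord.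
by move=> [x Kx <-]; exists (dotv x xi); rewrite -frame_complete.
Qed.

Lemma compact_shadow K : compact K -> compact (shadow K).
Proof. by rewrite shadow_image; apply: compact_image_rV; exact: continuous_mulmx. Qed.

Lemma le_projection_function K L : compact K -> compact L -> K `<=` L ->
  projection_function K xi <= projection_function L xi.
Proof.
move=> cK cL KL; rewrite !projection_functionE; apply: le_volume; try exact: compact_shadow.
by move=> y [t Kt]; exists t; exact: KL.
Qed.

Lemma projection_function_dilate a K : 0 < a -> compact K ->
  projection_function (dilate a K) xi = a ^+ m * projection_function K xi.
Proof.
move=> a0 cK; rewrite !projection_functionE -volume_dilate//; last exact: compact_shadow.
congr volume; rewrite !shadow_image; apply/seteqP; split=> y /=.
  by move=> [_ [x Kx <-] <-]; exists (x *m frame^T); [exists x|rewrite scalemxAl].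
by move=> [_ [x Kx <-] <-]; exists (a *: x); [exists x|rewrite scalemxAl].
Qed.

Lemma projection_function_translate v K : compact K ->
  projection_function [set x + v | x in K] xi = projection_function K xi.
Proof.
move=> cK; rewrite !projection_functionE.
rewrite /volume -(@lebesgue_rV_shift _ _ (- (v *m frame^T)) (shadow K)); last first.
  by apply: measurable_compact_rV; exact: compact_shadow.
congr (fine (lebesgue_rV _ _)); rewrite !shadow_image; apply/seteqP; split=> y /=.
  by move=> [_ [x Kx <-] <-]; exists x => //; rewrite mulmxDl addrK.
by move=> [x Kx xE]; exists (x + v); [exists x|rewrite mulmxDl xE subrK].
Qed.

Lemma projection_function_ge0 K : 0 <= projection_function K xi.
Proof. by rewrite projection_functionE; exact: volume_ge0. Qed.

End shadow.

(** * Separation of convex sets *)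

Lemma dotv_subZ (R : realType) n (a b : 'rV[R]_n) t :
  dotv (a - t *: b) (a - t *: b) = dotv a a - 2 * t * dotv a b + t ^+ 2 * dotv b b.
Proof.
rewrite dotvDl !dotvDr !dotvNl !dotvNr !dotvZl !dotvZr (dotvC b a); ring.
Qed.

Lemma continuous_subl (R : realType) (V : normedModType R) (x : V) :
  continuous (fun z => x - z).
Proof. by move=> z; apply: cvgB; [exact: cvg_cst|exact: cvg_id]. Qed.

Definition enorm (R : realType) n (x : 'rV[R]_n) : R := Num.sqrt (dotv x x).

Lemma enorm_gt0 (R : realType) n (x : 'rV[R]_n) : (0 < enorm x) = (x != 0).
Proof. by rewrite sqrtr_gt0 lt_def dotv_eq0 dotv_ge0 andbT. Qed.

Lemma enorm_ge0 (R : realType) n (x : 'rV[R]_n) : 0 <= enorm x.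
Proof. exact: sqrtr_ge0. Qed.

Lemma sqr_enorm (R : realType) n (x : 'rV[R]_n) : enorm x ^+ 2 = dotv x x.
Proof. by rewrite sqr_sqrtr// dotv_ge0. Qed.

Lemma enormZ (R : realType) n a (x : 'rV[R]_n) : enorm (a *: x) = `|a| * enorm x.
Proof.
by rewrite /enorm dotvZl dotvZr mulrA -expr2 sqrtrM ?sqr_ge0// sqrtr_sqr.
Qed.

Definition unit_dir (R : realType) n (x : 'rV[R]_n) := (enorm x)^-1 *: x.

Lemma unit_dirP (R : realType) n (x : 'rV[R]_n) : x != 0 -> sphere (unit_dir x).
Proof.
move=> x0; have e0 : enorm x != 0 by rewrite gt_eqF// enorm_gt0.
by rewrite /sphere /unit_dir /= dotvZl dotvZr -sqr_enorm; field.
Qed.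

Lemma unit_dirK (R : realType) n (x : 'rV[R]_n) : x != 0 -> enorm x *: unit_dir x = x.
Proof. by move=> x0; rewrite scalerKV// gt_eqF// enorm_gt0. Qed.

Lemma nearest_point (R : realType) n (K : set 'rV[R]_n) (x : 'rV[R]_n) :
  compact K -> convex_set K -> K !=set0 ->
  exists2 p, K p & forall z, K z -> dotv (x - p) (z - p) <= 0.
Proof.
move=> cK /convex_setP vK K0.
have cf : continuous (fun z : 'rV[R]_n => dotv (x - z) (x - z)).
  have cB := @continuous_subl _ 'rV[R]_n x.
  by move=> z; exact: (continuous_comp (cB z) (@continuous_dotvv R n _)).
have [p Kp pmin] := EVT_min_rV K0 cK (continuous_subspaceT cf).
exists p; first by rewrite -inE.
move: Kp; rewrite inE => Kp z Kz.
rewrite leNgt; apply/negP => c0.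
set c := dotv (x - p) (z - p) in c0.
set q := dotv (z - p) (z - p).
have q0 : 0 <= q by exact: dotv_ge0.
have cq : 0 < c + q by rewrite ltr_wpDr.
(* Moving from [p] towards [z] by [t] changes the squared distance to [x] by [t * (t * q - 2 * c)],
   negative for this [t]. The denominator [c + q] keeps [t] at most 1 and is positive even when
   [q = 0]. *)
pose t := c / (c + q).
have t0 : 0 < t by rewrite divr_gt0.
have t1 : t <= 1 by rewrite ler_pdivrMr// mul1r lerDl.
have := pmin (t *: z + (1 - t) *: p); rewrite inE => /(_ (vK _ _ _ (ltW t0) t1 Kz Kp)).
rewrite (_ : x - (t *: z + (1 - t) *: p) = (x - p) - t *: (z - p)); last first.
  by apply/rowP => i; rewrite !mxE; ring.
rewrite [leRHS]dotv_subZ -/c -/q.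
suff : t * q < 2 * c.
  rewrite -(ltr_pM2l t0) => h1 h2; lra.
rewrite /t mulrAC ltr_pdivrMr//; nra.
Qed.

(** The normal is the direction from the nearest point of [K] to [x], and the gap [e] is the
    distance. *)
Lemma separation (R : realType) n (K : set 'rV[R]_n) (x : 'rV[R]_n) :
  compact K -> convex_set K -> K !=set0 -> ~ K x ->
  exists theta e, [/\ sphere theta, 0 < e &
    forall z, K z -> dotv z theta + e <= dotv x theta].
Proof.
move=> cK vK K0 nKx; have [p Kp Hp] := nearest_point x cK vK K0.
have xp : x - p != 0 by rewrite subr_eq0; apply/eqP => xp; apply: nKx; rewrite xp.
have e0 : 0 < enorm (x - p) by rewrite enorm_gt0.
exists (unit_dir (x - p)), (enorm (x - p)); split=> //; first exact: unit_dirP.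
move=> z /Hp; rewrite dotvDr dotvNr => zp.
have := sqr_enorm (x - p); rewrite dotvDr dotvNr expr2 => ee.
set e := enorm (x - p) in e0 ee *.
rewrite /unit_dir -/e !dotvZr !(dotvC _ (x - p)) -subr_ge0.
rewrite (_ : _ - _ = e^-1 * (dotv (x - p) x - dotv (x - p) z - e * e)); last first.
  by field; rewrite gt_eqF.
by rewrite mulr_ge0 ?invr_ge0 ?(ltW e0)//; lra.
Qed.

Lemma compact_convex_itv (R : realType) (I : set R) :
  compact I -> I !=set0 ->
  (forall x y t, 0 <= t -> t <= 1 -> I x -> I y -> I (t * x + (1 - t) * y)) ->
  exists l r, l <= r /\ I = `[l, r]%classic.
Proof.
move=> cI I0 vI.
have cid : {within I, continuous (fun x : R => x)} by apply: continuous_subspaceT => x; exact: cvg_id.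
have [l Il lmin] := compact_EVT_min I0 cI cid.
have [r Ir rmax] := compact_EVT_max I0 cI cid.
exists l, r; split; first exact: lmin.
move: Il Ir; rewrite !inE => Il Ir.
apply/seteqP; split=> x /=.
  by move=> Ix; rewrite in_itv/= lmin ?inE// rmax ?inE.
rewrite in_itv/= => /andP[lx xr].
have [lr|lr] := eqVneq l r.
  by rewrite (_ : x = l)//; apply/eqP; rewrite eq_le lx andbT lr.
have lr0 : 0 < r - l by rewrite subr_gt0 lt_def eq_sym lr (le_trans lx xr).
rewrite (_ : x = ((r - x) / (r - l)) * l + (1 - (r - x) / (r - l)) * r); last first.
  by field; rewrite gt_eqF.
apply: vI => //; first by rewrite divr_ge0// ?(ltW lr0)// subr_ge0.
by rewrite ler_pdivrMr// mul1r; lra.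
Qed.

(** * Sums of segments *)

(** The Minkowski sum of [K] and the segment [-v, v]. Iterating it gives [zono], which is a zonotope
    when it starts from the origin. *)
Definition seg (R : realType) n (v : 'rV[R]_n) (K : set 'rV[R]_n) : set 'rV[R]_n :=
  [set z | exists x t, [/\ K x, `|t| <= 1 & z = x + t *: v]].

Definition zono (R : realType) n (K : set 'rV[R]_n) (vs : seq 'rV[R]_n) :=
  foldr (@seg R n) K vs.

Lemma sub_seg (R : realType) n (v : 'rV[R]_n) (K : set 'rV[R]_n) : K `<=` seg v K.
Proof. by move=> x Kx; exists x, 0; rewrite normr0 ler01 scale0r addr0. Qed.

Lemma compact_seg (R : realType) n (v : 'rV[R]_n) (K : set 'rV[R]_n) :
  compact K -> compact (seg v K).
Proof.
move=> cK; rewrite (_ : seg v K = minkowski_sum K ((fun t : R => t *: v) @` `[-1, 1]%classic)).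
  apply: compact_minkowski_sum => //; apply: continuous_compact; last exact: segment_compact.
  by apply: continuous_subspaceT => t; exact: scalel_continuous.
apply/seteqP; split=> z /=.
  move=> [x [t [Kx t1 ->]]]; exists x => //; exists (t *: v) => //.
  by exists t => //=; rewrite in_itv/= -ler_norml.
move=> [x Kx [_ [t /= t1 <-] <-]]; exists x, t; split=> //.
by move: t1; rewrite in_itv/= -ler_norml.
Qed.

Lemma convex_seg (R : realType) n (v : 'rV[R]_n) (K : set 'rV[R]_n) :
  convex_set K -> convex_set (seg v K).
Proof.
move=> /convex_setP vK; apply/convex_setP => _ _ t t0 t1 [x [a [Kx a1 ->]]] [y [b [Ky b1 ->]]].
exists (t *: x + (1 - t) *: y), (t * a + (1 - t) * b); split; first exact: vK.
  by move: a1 b1; rewrite !ler_norml => /andP[? ?] /andP[? ?]; apply/andP; split; nra.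
by apply/rowP => i; rewrite !mxE; ring.
Qed.

Lemma compact_zono (R : realType) n (K : set 'rV[R]_n) vs : compact K -> compact (zono K vs).
Proof. by move=> cK; elim: vs => [|v vs IH] //=; exact: compact_seg. Qed.

Lemma convex_zono (R : realType) n (K : set 'rV[R]_n) vs : convex_set K -> convex_set (zono K vs).
Proof. by move=> cK; elim: vs => [|v vs IH] //=; exact: convex_seg. Qed.

Lemma sub_zono (R : realType) n (K : set 'rV[R]_n) vs : K `<=` zono K vs.
Proof. by elim: vs => [|v vs IH] //=; apply: (subset_trans IH); exact: sub_seg. Qed.

Lemma minkowski_sum_zono (R : realType) n (A B : set 'rV[R]_n) vs :
  minkowski_sum A (zono B vs) = zono (minkowski_sum A B) vs.
Proof.
elim: vs => [//|v vs /= <-]; apply/seteqP; split=> z.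
  move=> [x Ax [_ [y [t [By t1 ->]]] <-]]; exists (x + y), t; split=> //; last by rewrite addrA.
  by exists x => //; exists y.
move=> [_ [t [[x Ax [y By <-]] t1 ->]]]; exists x => //; exists (y + t *: v); last by rewrite addrA.
by exists y, t.
Qed.

Lemma minkowski_sum0 (R : realType) n (A : set 'rV[R]_n) : minkowski_sum A [set 0] = A.
Proof.
apply/seteqP; split=> z; first by move=> [x Ax [_ -> <-]]; rewrite addr0.
by move=> Az; exists z => //; exists 0 => //; rewrite addr0.
Qed.

Lemma zonoE (R : realType) n (A : set 'rV[R]_n) vs : zono A vs = minkowski_sum A (zono [set 0] vs).
Proof. by rewrite minkowski_sum_zono minkowski_sum0. Qed.

Lemma zono_dilate (R : realType) n (s : R) vs :
  zono [set (0 : 'rV[R]_n)] [seq s *: v | v <- vs] = dilate s (zono [set 0] vs).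
Proof.
elim: vs => [|v vs /= ->].
  apply/seteqP; split=> z /=; first by move=> ->; exists 0 => //; rewrite scaler0.
  by move=> [_ -> <-]; rewrite scaler0.
apply/seteqP; split=> z.
  move=> [_ [t [[x Zx <-] t1 ->]]]; exists (x + t *: v); first by exists x, t.
  by rewrite scalerDr !scalerA mulrC.
move=> [_ [x [t [Zx t1 ->]]] <-]; exists (s *: x), t; split=> //; first by exists x.
by rewrite scalerDr !scalerA mulrC.
Qed.

(** The support function of the zonotope generated by [vs], by the next two lemmas. *)
Definition zono_support (R : realType) n (vs : seq 'rV[R]_n) theta : R :=
  \sum_(v <- vs) `|dotv v theta|.

Lemma zono_support_ub (R : realType) n (vs : seq 'rV[R]_n) theta z :
  zono [set 0] vs z -> dotv z theta <= zono_support vs theta.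
Proof.
rewrite /zono_support; elim: vs z => [|v vs IH] z /=; first by move=> ->; rewrite big_nil dot0v.
move=> [x [t [/IH Zx t1 ->]]]; rewrite big_cons dotvDl dotvZl addrC lerD//.
by rewrite (le_trans (ler_norm _))// normrM ler_piMl.
Qed.

Lemma zono_support_max (R : realType) n (vs : seq 'rV[R]_n) theta :
  exists2 z, zono [set 0] vs z & dotv z theta = zono_support vs theta.
Proof.
rewrite /zono_support; elim: vs => [|v vs [z Zz zE]] /=.
  by exists 0 => //; rewrite big_nil dot0v.
exists (z + (Num.sg (dotv v theta)) *: v).
  by exists z, (Num.sg (dotv v theta)); split=> //; rewrite normr_sg lern1 leq_b1.
by rewrite big_cons dotvDl zE dotvZl addrC normrEsg.
Qed.

Section steiner.
Context (R : realType) (m : nat).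
Implicit Types (K L : set 'rV[R]_m.+1) (v : 'rV[R]_m.+1).

(** The volume gained by adding [-v, v] to [K], see [volume_seg]. A zero vector has no direction and
    adds nothing. *)
Definition seg_gain K v : R :=
  if v == 0 then 0 else 2 * enorm v * projection_function K (unit_dir v).

(** Every line of direction [xi] that meets [K] does so in a segment, which grows by [a] at both
    ends. Integrating the gain [2 * a] over the shadow gives the formula. *)
Let seg_gain_aux K (xi : 'rV[R]_m.+1) (a : R) : compact K -> convex_set K -> sphere xi -> 0 < a ->
  volume (seg (a *: xi) K) = volume K + 2 * a * projection_function K xi.
Proof.
move=> cK vK xi1 a0.
have cS := @compact_seg _ _ (a *: xi) _ cK.
have mK := measurable_compact_rV cK.
have mS := measurable_compact_rV cS.
have BF := frameP xi1.
pose B := frame xi; pose Sh := shadow xi K.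
have mSh : measurable Sh by apply: measurable_compact_rV; exact: compact_shadow.
apply/EFin_inj; rewrite EFinD -!lebesgue_rV_compact//.
rewrite projection_functionE// EFinM -lebesgue_rV_compact; last exact: compact_shadow.
rewrite !(lebesgue_rV_fubini xi1 BF)//.
have -> : ((2 * a)%:E * lebesgue_rV m (shadow xi K) =
   \int[lebesgue_rV m]_y ((2 * a)%:E * (\1_Sh y)%:E))%E.
  rewrite ge0_integralZl ?integral_indic ?setIT//.
    by apply/measurable_EFinP; exact: measurable_indic.
  by rewrite lee_fin mulr_ge0// ltW.
rewrite -ge0_integralD//; last 3 first.
- by apply: measurable_line_measure.
- by move=> y _; rewrite mule_ge0// lee_fin mulr_ge0// ltW.
- by apply: measurable_funeM; apply/measurable_EFinP; exact: measurable_indic.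
apply: eq_integral => y _.
pose I := [set t : R | K (t *: xi + y *m B)].
have SE : [set t : R | seg (a *: xi) K (t *: xi + y *m B)] =
  [set t + s | t in I & s in `[-a, a]%classic].
  apply/seteqP; split=> t /=.
    move=> [x [s [Kx s1 xE]]]; exists (t - s * a).
      by rewrite /I /= (_ : _ + _ = x)// scalerBl addrAC xE scalerA addrK.
    exists (s * a); last by rewrite subrK.
    move: s1; rewrite in_itv/= ler_norml => /andP[? ?]; apply/andP; split; nra.
  move=> [u Iu [s sa <-]]; exists (u *: xi + y *m B), (s / a); split=> //.
    rewrite ler_norml ler_pdivrMr// ler_pdivlMr//; move: sa; rewrite in_itv/=.
    by rewrite mulN1r mul1r.
  by rewrite scalerA divfK ?gt_eqF// scalerDl addrAC.
rewrite /line_measure -/B SE -/I.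
have [Shy|nShy] := pselect (Sh y); last first.
  rewrite indicE memNset// mule0 adde0 (_ : I = set0).
    by congr lebesgue_measure; apply/seteqP; split=> // t [].
  by apply/seteqP; split=> // t It; apply: nShy; exists t.
rewrite indicE mem_set// mule1.
have I0 : I !=set0 by case: Shy => t; exists t.
have cI : compact I.
  (* The fibre is compact as the image, under the coordinate along [xi], of a closed part of [K]. *)
  rewrite (_ : I = (fun x => dotv x xi) @` (K `&` [set x | x *m B^T = y])).
    apply: continuous_compact; first by apply: continuous_subspaceT; exact: continuous_dotv.
    apply: compact_closedI => //.
    have /continuous_closedP cB := @continuous_mulmx R _ _ B^T.
    apply: (cB [set y]).
    by apply: accessible_closed_set1; apply: hausdorff_accessible; exact: norm_hausdorff.
  apply/seteqP; split=> t /=.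
    move=> It; exists (t *: xi + y *m B); last first.
      by rewrite dotvDl dotvZl dotv_frame// addr0 (xi1 : dotv xi xi = 1) mulr1.
    by split=> //=; rewrite frame_coord.
  by move=> [x [Kx xy] <-]; rewrite /I /= -xy -frame_complete.
have vI x z t : 0 <= t -> t <= 1 -> I x -> I z -> I (t * x + (1 - t) * z).
  move=> t0 t1 Ix Iz; have := (convex_setP K).1 vK _ _ t t0 t1 Ix Iz.
  rewrite /I /=; congr K; apply/rowP => i; rewrite !mxE; ring.
have [l [r [lr ->]]] := compact_convex_itv cI I0 vI.
rewrite (_ : [set _ | _ in _ & _ in _] = `[l - a, r + a]%classic).
  rewrite !lebesgue_measure_itv/= !lte_fin ifT; last by lra.
  case: ifPn => [lr'|]; first by rewrite -!EFinB -EFinD; congr EFin; ring.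
  rewrite -leNgt => rl; rewrite add0e -EFinB; congr EFin; lra.
apply/seteqP; split=> t /=.
  move=> [u + [s + <-]]; rewrite !in_itv/= => /andP[? ?] /andP[? ?]; apply/andP; split; lra.
rewrite in_itv/= => /andP[t1 t2].
have [tl|tl] := leP t l.
  by exists l; rewrite ?in_itv/= ?lexx//; exists (t - l); rewrite ?in_itv/=; [apply/andP; split; lra|ring].
have [tr|tr] := leP t r.
  by exists t; rewrite ?in_itv/= ?(ltW tl)//; exists 0; rewrite ?in_itv/= ?addr0//; apply/andP; split; lra.
by exists r; rewrite ?in_itv/= ?lexx ?andbT//; exists (t - r); rewrite ?in_itv/=; [apply/andP; split; lra|ring].
Qed.

Lemma volume_seg K v : compact K -> convex_set K ->
  volume (seg v K) = volume K + seg_gain K v.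
Proof.
move=> cK vK; rewrite /seg_gain; case: eqVneq => [->|v0].
  rewrite addr0; congr volume; apply/seteqP; split; last exact: sub_seg.
  by move=> z [x [t [Kx _ ->]]]; rewrite scaler0 addr0.
by rewrite -{1}(unit_dirK v0) seg_gain_aux ?enorm_gt0//; exact: unit_dirP.
Qed.

Lemma le_seg_gain K L v : compact K -> compact L -> K `<=` L -> seg_gain K v <= seg_gain L v.
Proof.
move=> cK cL KL; rewrite /seg_gain; case: eqVneq => // v0.
by rewrite ler_wpM2l ?mulr_ge0 ?enorm_ge0//; apply: le_projection_function => //; exact: unit_dirP.
Qed.

Lemma seg_gain_ge0 K v : 0 <= seg_gain K v.
Proof.
rewrite /seg_gain; case: eqVneq => // v0.
by rewrite !mulr_ge0 ?enorm_ge0// projection_function_ge0//; exact: unit_dirP.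
Qed.

Lemma seg_gain_dilate K v a : compact K -> 0 < a -> seg_gain (dilate a K) v = a ^+ m * seg_gain K v.
Proof.
move=> cK a0; rewrite /seg_gain; case: eqVneq => [_|v0]; first by rewrite mulr0.
by rewrite projection_function_dilate//; [ring|exact: unit_dirP].
Qed.

Lemma seg_gainZ K v s : 0 < s -> seg_gain K (s *: v) = s * seg_gain K v.
Proof.
move=> s0; rewrite /seg_gain scaler_eq0 gt_eqF//=; case: eqVneq => [_|v0]; first by rewrite mulr0.
rewrite /unit_dir enormZ gtr0_norm// scalerA (_ : (s * enorm v)^-1 * s = (enorm v)^-1); first ring.
by field; rewrite gt_eqF ?enorm_gt0// gt_eqF.
Qed.

(** Each segment gains the [seg_gain] of the body built so far, which contains [K]. For the converse
    bound that body lies in [dilate b K], whose shadows are [b ^+ m] times larger. The two bounds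
    agree to first order when the segments shrink. *)
Lemma volume_zono_ge K vs : compact K -> convex_set K ->
  volume K + \sum_(v <- vs) seg_gain K v <= volume (zono K vs).
Proof.
move=> cK vK; elim: vs => [|v vs IH] /=; first by rewrite big_nil addr0.
rewrite big_cons volume_seg; [|exact: compact_zono|exact: convex_zono].
rewrite addrCA addrC lerD//; apply: le_seg_gain => //; first exact: compact_zono.
exact: sub_zono.
Qed.

Lemma volume_zono_le K vs b : compact K -> convex_set K -> 0 < b ->
  zono K vs `<=` dilate b K ->
  volume (zono K vs) <= volume K + b ^+ m * \sum_(v <- vs) seg_gain K v.
Proof.
move=> cK vK b0; elim: vs => [|v vs IH] /= Kb; first by rewrite big_nil mulr0 addr0.
have Kb' : zono K vs `<=` dilate b K by apply: subset_trans Kb; exact: sub_seg.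
rewrite big_cons volume_seg; [|exact: compact_zono|exact: convex_zono].
have := le_seg_gain v (@compact_zono _ _ _ vs cK) (@compact_dilate _ _ b _ cK) Kb'.
rewrite seg_gain_dilate// => h; have := IH Kb'; lra.
Qed.

End steiner.

(** * The Brunn-Minkowski inequality *)

(** With [a] the maximum of [X] and [b] the minimum of [Y], the translates X + b and a + Y both lie
    in [Z] and meet only at a + b. Removing [a] from [X] makes them disjoint at no cost in
    measure. *)
Lemma lebesgue_measure_add_ge_compact (R : realType) (X Y Z : set (measurableTypeR R)) :
  compact (X : set R) -> compact (Y : set R) -> X !=set0 -> Y !=set0 -> measurable Z ->
  (forall x y : R, X x -> Y y -> Z (x + y)) ->
  (lebesgue_measure X + lebesgue_measure Y <= lebesgue_measure Z)%E.
Proof.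
move=> cX cY X0 Y0 mZ XYZ.
have mX : measurable X by apply: closed_measurable; apply: compact_closed cX; exact: Rhausdorff.
have mY : measurable Y by apply: closed_measurable; apply: compact_closed cY; exact: Rhausdorff.
have cid (I : set R) : {within I, continuous (fun x : R => x)}.
  by apply: continuous_subspaceT => x; exact: cvg_id.
have [a Xa amax] := compact_EVT_max X0 cX (cid _).
have [b Yb bmin] := compact_EVT_min Y0 cY (cid _).
rewrite inE in Xa; rewrite inE in Yb.
pose X' : set (measurableTypeR R) := (fun t : R => t + - b) @^-1` (X `\ a).
pose Y' : set (measurableTypeR R) := (fun t : R => t + - a) @^-1` Y.
have mXa : measurable (X `\ a : set (measurableTypeR R)) by apply: measurableD => //; exact: measurable_set1.
have msh (c : R) (A : set (measurableTypeR R)) : measurable A ->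
    measurable ((fun t : R => t + c) @^-1` A : set (measurableTypeR R)).
  by move=> mA; rewrite -[X in measurable X]setTI; exact: measurable_funD.
have <- : lebesgue_measure X' = lebesgue_measure X.
  rewrite lebesgue_measure_shift// -[in RHS](setD1K Xa) measureU//.
  - by rewrite [X in (X + _)%E]lebesgue_measure_set1 add0e.
  - by apply/seteqP; split=> // t [-> [_]]; exact.
rewrite -(lebesgue_measure_shift (- a) mY) -measureU//; last 3 first.
- exact: msh.
- exact: msh.
- apply/seteqP; split=> // t [[/= X1 X2] Y1].
  have := amax (t - b); have := bmin (t - a); rewrite !inE => /(_ Y1) h1 /(_ X1) h2.
  by apply: X2; lra.
apply: le_measure; rewrite ?inE//; first by apply: measurableU; exact: msh.
move=> t [[X1 _]|Y1].
  by have := XYZ _ _ X1 Yb; rewrite subrK.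
by have := XYZ _ _ Xa Y1; rewrite addrC subrK.
Qed.

Lemma lebesgue_measure_add_ge (R : realType) (X Y Z : set (measurableTypeR R)) :
  measurable X -> measurable Y -> X !=set0 -> Y !=set0 -> measurable Z ->
  (lebesgue_measure X < +oo)%E -> (lebesgue_measure Y < +oo)%E ->
  (forall x y : R, X x -> Y y -> Z (x + y)) ->
  (lebesgue_measure X + lebesgue_measure Y <= lebesgue_measure Z)%E.
Proof.
move=> mX mY X0 Y0 mZ fX fY XYZ; apply/lee_addgt0Pr => e e0.
have aux (A : set (measurableTypeR R)) : measurable A -> A !=set0 -> (lebesgue_measure A < +oo)%E ->
    exists V : set R, [/\ compact V, V `<=` A, V !=set0 &
      (lebesgue_measure A <= lebesgue_measure V + (e / 2)%:E)%E].
  move=> mA [a Aa] fA.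
  have [V [cV VA AV]] := lebesgue_regularity_inner mA fA (divr_gt0 e0 (ltr0n _ 2)).
  (* The inner approximation may be empty; adding a point of [A] prevents this. *)
  exists (V `|` [set a]); split.
  - by apply: compactU => //; exact: compact_set1.
  - by move=> x [/VA//|->].
  - by exists a; right.
  have mV : measurable (V : set (measurableTypeR R)).
    by apply: closed_measurable; apply: compact_closed cV; exact: Rhausdorff.
  apply: (@le_trans _ _ (lebesgue_measure V + (e / 2)%:E)%E); last first.
    apply: leeD => //; apply: le_measure; rewrite ?inE//.
    by apply: measurableU => //; exact: measurable_set1.
  rewrite -[in leLHS](setDUK VA) measureU//; last 2 first.
  - exact: measurableD.
  - by apply/seteqP; split=> // t [? []].
  by apply: leeD => //; exact: ltW.
have [V [cV VX V0 hV]] := aux _ mX X0 fX.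
have [W [cW WY W0 hW]] := aux _ mY Y0 fY.
have := lebesgue_measure_add_ge_compact cV cW V0 W0 mZ (fun x y Vx Wy => XYZ x y (VX _ Vx) (WY _ Wy)).
move=> H; apply: (le_trans (leeD hV hW)).
rewrite addeACA -EFinD -splitr; exact: leeD.
Qed.

(** Both sides measure the region under the graph, cut vertically and horizontally. The condition
    [0 <= t] sits in the level set so that levels range over the whole line. *)
Lemma integral_layer_cake (R : realType) (f : R -> R) :
  measurable_fun [set: measurableTypeR R] (f : measurableTypeR R -> measurableTypeR R) ->
  (forall x, 0 <= f x) ->
  (\int[@lebesgue_measure R]_x (f x)%:E =
   \int[@lebesgue_measure R]_t (lebesgue_measure [set x : R | (0 <= t)%R && (t < f x)%R]))%E
  /\ measurable_fun [set: measurableTypeR R]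
      (fun t : R => lebesgue_measure [set x : R | (0 <= t)%R && (t < f x)%R]).
Proof.
move=> mf f0.
pose W := [set p : measurableTypeR R * measurableTypeR R | (0 <= p.2)%R && (p.2 < f p.1)%R].
have mW : measurable W.
  pose g (p : measurableTypeR R * measurableTypeR R) : measurableTypeR R := f p.1 - p.2.
  have mg : measurable_fun setT g.
    apply: measurable_funB; last exact: measurable_snd.
    by apply: (measurableT_comp mf); exact: measurable_fst.
  rewrite (_ : W = (snd @^-1` `[0%R, +oo[%classic) `&` (g @^-1` `]0%R, +oo[%classic)).
    apply: measurableI.
      rewrite -[X in measurable X]setTI; apply: measurable_snd => //; exact: measurable_itv.
    rewrite -[X in measurable X]setTI; apply: mg => //; exact: measurable_itv.
  by apply/seteqP; split=> p; rewrite /W /g /= !in_itv/= !andbT subr_gt0 => /andP.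
have ysE t : ysection W t = [set x : R | (0 <= t)%R && (t < f x)%R].
  by apply/seteqP; split=> x; rewrite /ysection/= inE.
split; last first.
  have := measurable_fun_ysection (@lebesgue_measure R) mW.
  by congr measurable_fun; apply/funext => t; rewrite /= ysE.
rewrite (eq_integral (fun x => lebesgue_measure (xsection W x))); last first.
  move=> x _; rewrite (_ : xsection W x = `[0, f x[%classic).
    rewrite lebesgue_measure_itv/= lte_fin; case: ltP => [_|fx]; first by rewrite -EFinB subr0.
    by congr EFin; apply/eqP; rewrite eq_le fx f0.
  by apply/seteqP; split=> t; rewrite /xsection/= inE /W /= in_itv.
by rewrite integral_xsection_ysection//; apply: eq_integral => t _; rewrite ysE.
Qed.

(** Young's inequality with the conjugate exponents 1/(1 - l) and 1/l. *)
Lemma weighted_AGM (R : realType) (x y l : R) : 0 < l -> l < 1 -> 0 <= x -> 0 <= y ->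
  x `^ (1 - l) * y `^ l <= (1 - l) * x + l * y.
Proof.
move=> l0 l1 x0 y0.
have l1' : 1 - l != 0 by rewrite subr_eq0 gt_eqF.
have := @conjugate_powR R (x `^ (1 - l)) (y `^ l) (1 - l)^-1 l^-1 (powR_ge0 _ _) (powR_ge0 _ _).
rewrite !invr_gt0 subr_gt0 !invrK subrK -!powRrM (divff l1') (divff (lt0r_neq0 l0)) !powRr1//.
by move=> /(_ l1 l0 erefl); rewrite [x * _]mulrC [y * _]mulrC.
Qed.

Lemma lebesgue_measure_scale (R : realType) (c : R) (X : set (measurableTypeR R)) :
  0 < c -> measurable X ->
  lebesgue_measure ((fun t : R => c^-1 * t) @^-1` X) = (c%:E * lebesgue_measure X)%E.
Proof.
move=> c0 mX; have ci0 : 0 < c^-1 by rewrite invr_gt0.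
rewrite [in RHS](lebesgue_measure_affine 0 ci0 mX) muleA -EFinM divff ?gt_eqF// mul1e.
by congr lebesgue_measure; apply/funext => t; rewrite /preimage/= addr0.
Qed.

(** Dividing [F] and [G] by their suprema [a] and [b] makes both superlevel sets
    nonempty for every level [t < 1], as [lebesgue_measure_add_ge] requires. *)
Section prekopa_leindler.
Context (R : realType) (l : R) (F G H : R -> R) (a b r : R).
Hypotheses (l0 : 0 < l) (l1 : l < 1) (a0 : 0 < a) (b0 : 0 < b).
Hypotheses
  (mF : measurable_fun [set: measurableTypeR R] (F : measurableTypeR R -> measurableTypeR R))
  (mG : measurable_fun [set: measurableTypeR R] (G : measurableTypeR R -> measurableTypeR R))
  (mH : measurable_fun [set: measurableTypeR R] (H : measurableTypeR R -> measurableTypeR R)).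
Hypotheses (F0 : forall s, 0 <= F s) (G0 : forall s, 0 <= G s) (H0 : forall s, 0 <= H s).
Hypotheses (Fa : forall s, F s <= a) (Gb : forall s, G s <= b).
Hypotheses (supF : forall t, t < a -> exists s, t < F s) (supG : forall t, t < b -> exists s, t < G s).
Hypotheses (Fr : forall s, 0 < F s -> `|s| <= r) (Gr : forall s, 0 < G s -> `|s| <= r).
Hypothesis FGH : forall s u, F s `^ (1 - l) * G u `^ l <= H ((1 - l) * s + l * u).

Let c := a `^ (1 - l) * b `^ l.

Let c0 : 0 < c. Proof. by rewrite mulr_gt0// powR_gt0. Qed.

Let l1' : 0 < 1 - l. Proof. by rewrite subr_gt0. Qed.

Let superlevel (f : R -> R) (e t : R) : set (measurableTypeR R) :=
  [set x | (0 <= t) && (t < f x / e)].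

Let superlevel_measurable f (e t : R) :
  measurable_fun [set: measurableTypeR R] (f : measurableTypeR R -> measurableTypeR R) ->
  measurable (superlevel f e t).
Proof.
move=> mf; rewrite /superlevel; case: (0 <= t) => /=; last first.
  by rewrite (_ : [set _ | _] = set0)//; apply/seteqP; split.
have mfe : measurable_fun [set: measurableTypeR R] (fun x => f x / e : measurableTypeR R).
  exact: measurable_funM.
rewrite (_ : [set _ | _] = (fun x => f x / e) @^-1` `]t, +oo[%classic).
  by rewrite -[X in measurable X]setTI; apply: mfe => //; exact: measurable_itv.
by apply/seteqP; split=> x /=; rewrite in_itv/= andbT.
Qed.

Let bounded_lt (X : set (measurableTypeR R)) : measurable X -> (forall x : R, X x -> `|x| <= r) ->
  (lebesgue_measure X < +oo)%E.
Proof.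
move=> mX Xr; apply: (@le_lt_trans _ _ (lebesgue_measure (`[- `|r|, `|r|]%classic : set R))).
  apply: le_measure; rewrite ?inE//.
  by move=> x /Xr xr; rewrite /= in_itv/= -ler_norml (le_trans xr)// ler_norm.
by rewrite lebesgue_measure_itv/=; case: ifP => _; rewrite ?ltry// -EFinB ltry.
Qed.

(** For [0 <= t < 1] the hypothesis [FGH] places the combination of the two level sets in that of
    [H / c], and the one-dimensional sum inequality applies. At any other level the left-hand side
    is 0. *)
Let superlevel_ge t :
  ((1 - l)%:E * lebesgue_measure (superlevel F a t) +
   l%:E * lebesgue_measure (superlevel G b t) <= lebesgue_measure (superlevel H c t))%E.
Proof.
have [t0|t0] := ltP t 0.
  have e0 f e : superlevel f e t = set0.
    by apply/seteqP; split=> // x /andP[]; rewrite leNgt t0.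
  by rewrite !e0 measure0 !mule0 adde0.
have [t1|t1] := leP 1 t.
  have -> : superlevel F a t = set0.
    apply/seteqP; split=> // x /andP[_]; rewrite ltr_pdivlMr// => h.
    by have := Fa x; rewrite leNgt (le_lt_trans _ h)// ler_peMl// ltW.
  have -> : superlevel G b t = set0.
    apply/seteqP; split=> // x /andP[_]; rewrite ltr_pdivlMr// => h.
    by have := Gb x; rewrite leNgt (le_lt_trans _ h)// ler_peMl// ltW.
  by rewrite measure0 !mule0 adde0.
have mX := superlevel_measurable a t mF.
have mY := superlevel_measurable b t mG.
have mZ := superlevel_measurable c t mH.
have ta : t * a < a by rewrite gtr_pMl.
have [s0 ts0] := supF ta.
have tb : t * b < b by rewrite gtr_pMl.
have [u0 tu0] := supG tb.
have fX : (lebesgue_measure (superlevel F a t) < +oo)%E.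
  apply: bounded_lt => // x /andP[_]; rewrite ltr_pdivlMr// => h; apply: Fr.
  by apply: le_lt_trans h; rewrite mulr_ge0// ltW.
have fY : (lebesgue_measure (superlevel G b t) < +oo)%E.
  apply: bounded_lt => // x /andP[_]; rewrite ltr_pdivlMr// => h; apply: Gr.
  by apply: le_lt_trans h; rewrite mulr_ge0// ltW.
have msc (e : R) (A : set (measurableTypeR R)) : measurable A ->
    measurable ((fun t : R => e^-1 * t) @^-1` A : set (measurableTypeR R)).
  by move=> mA; rewrite -[X in measurable X]setTI; exact: measurable_funM.
rewrite -!lebesgue_measure_scale//; apply: lebesgue_measure_add_ge => //; try exact: msc.
- by exists ((1 - l) * s0); rewrite /superlevel /= mulKf ?gt_eqF// t0 ltr_pdivlMr.
- by exists (l * u0); rewrite /superlevel /= mulKf ?gt_eqF// t0 ltr_pdivlMr.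
- by rewrite lebesgue_measure_scale// lte_mul_pinfty// ?lee_fin ?(ltW l1')//= .
- by rewrite lebesgue_measure_scale// lte_mul_pinfty// ?lee_fin ?(ltW l0)//= .
move=> x y; rewrite /superlevel /= t0/= !ltr_pdivlMr// => hx hy.
have := FGH ((1 - l)^-1 * x) (l^-1 * y); rewrite !mulVKf ?gt_eqF// => h.
apply: lt_le_trans h.
(* Splitting the level in the proportions of [c] lets the two factors be compared separately. *)
have t1E : t = t `^ (1 - l) * t `^ l.
  have [->|tn0] := eqVneq t 0; first by rewrite !powR0 ?gt_eqF// mul0r.
  by rewrite -powRD ?subrK ?powRr1// tn0 implybT.
rewrite {1}t1E /c mulrACA -!powRM ?(ltW a0) ?(ltW b0)//.
have hx' : (t * a) `^ (1 - l) < F ((1 - l)^-1 * x) `^ (1 - l).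
  by apply: gt0_ltr_powR; rewrite ?nnegrE// mulr_ge0// ltW.
have hy' : (t * b) `^ l < G (l^-1 * y) `^ l.
  by apply: gt0_ltr_powR; rewrite ?nnegrE// mulr_ge0// ltW.
by apply: ltr_pM => //; exact: powR_ge0.
Qed.

(** [superlevel_ge] integrated over the levels. The conclusion stays additive; [brunn_minkowski]
    turns it into a product by [weighted_AGM]. *)
Lemma prekopa_leindler :
  ((1 - l)%:E * \int[@lebesgue_measure R]_s (F s / a)%:E +
   l%:E * \int[@lebesgue_measure R]_s (G s / b)%:E <=
   \int[@lebesgue_measure R]_s (H s / c)%:E)%E.
Proof.
have mdiv (f : R -> R) (e : R) :
  measurable_fun [set: measurableTypeR R] (f : measurableTypeR R -> measurableTypeR R) ->
  measurable_fun [set: measurableTypeR R] (fun x => f x / e : measurableTypeR R).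
  by move=> mf; exact: measurable_funM.
have [-> mF'] := integral_layer_cake (mdiv F a mF) (fun x => divr_ge0 (F0 x) (ltW a0)).
have [-> mG'] := integral_layer_cake (mdiv G b mG) (fun x => divr_ge0 (G0 x) (ltW b0)).
have [-> mH'] := integral_layer_cake (mdiv H c mH) (fun x => divr_ge0 (H0 x) (ltW c0)).
rewrite -!ge0_integralZl ?lee_fin ?(ltW l0) ?(ltW l1')//.
rewrite -ge0_integralD//; last 4 first.
- by move=> x _; rewrite mule_ge0// lee_fin ltW.
- exact: measurable_funeM.
- by move=> x _; rewrite mule_ge0// lee_fin ltW.
- exact: measurable_funeM.
apply: ge0_le_integral => //.
- by move=> x _; rewrite adde_ge0// mule_ge0// lee_fin ltW.
- by apply: emeasurable_funD; exact: measurable_funeM.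
- by move=> t _; exact: superlevel_ge.
Qed.

End prekopa_leindler.

(** Induction on the dimension: the induction hypothesis, applied to slices by the first coordinate,
    is the assumption of [prekopa_leindler] for the slice volumes. *)
Lemma brunn_minkowski (R : realType) n (l : R) (A B C : set 'rV[R]_n) :
  0 < l -> l < 1 -> compact A -> compact B -> compact C ->
  (forall x y, A x -> B y -> C ((1 - l) *: x + l *: y)) ->
  volume A `^ (1 - l) * volume B `^ l <= volume C.
Proof.
move=> l0 l1; have l1' : 0 < 1 - l by rewrite subr_gt0.
have vol0 k : volume (set0 : set 'rV[R]_k) = 0 by rewrite /volume measure0.
elim: n A B C => [|n IH] A B C cA cB cC ABC.
  have [A0|/set0P[x Ax]] := eqVneq A set0.
    by rewrite A0 vol0 powR0 ?gt_eqF// mul0r volume_ge0.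
  have [B0|/set0P[y By]] := eqVneq B set0.
    by rewrite B0 vol0 powR0 ?gt_eqF// mulr0 volume_ge0.
  have triv (D : set 'rV[R]_0) z : D z -> volume D = 1.
    move=> Dz; transitivity (fine (\d_(0 : 'rV[R]_0) D : \bar R)) => //.
    by rewrite diracE mem_set// (_ : 0 = z)//; apply/rowP => -[].
  by rewrite (triv _ _ Ax) (triv _ _ By) (triv _ _ (ABC _ _ Ax By)) !powR1 mulr1.
(* A zero volume makes the left-hand side vanish. Otherwise the slice volumes have positive suprema,
   by which they can be normalised. *)
have [A0|A0] := eqVneq (volume A) 0.
  by rewrite A0 powR0 ?gt_eqF// mul0r volume_ge0.
have [B0|B0] := eqVneq (volume B) 0.
  by rewrite B0 powR0 ?gt_eqF// mulr0 volume_ge0.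
pose sl (D : set 'rV[R]_n.+1) (s : R) : set 'rV[R]_n := [set y | D (cons_rV (s, y))].
have csl D s : compact D -> compact (sl D s).
  move=> cD.
  rewrite (_ : sl D s = (fun x : 'rV[R]_n.+1 => (uncons_rV x).2) @` (D `&` [set x | x ord0 ord0 = s])).
    apply: compact_image_rV.
      apply: continuous_rV => i.
      rewrite (_ : (fun _ => _) = (fun x : 'rV[R]_n.+1 => x ord0 (lift ord0 i))).
        exact: coord_continuous.
      by apply/funext => x; rewrite mxE.
    apply: compact_closedI => //.
    have /continuous_closedP cB' := @coord_continuous R 1 n.+1 ord0 ord0.
    by apply: (cB' [set s]).
  apply/seteqP; split=> y /=.
    move=> Dy; exists (cons_rV (s, y)); first by split=> //=; rewrite cons_rV0.
    by apply/rowP => i; rewrite mxE cons_rVS.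
  by move=> [x [Dx xs] <-]; rewrite /sl /= -xs -[(x ord0 ord0, _)]/(uncons_rV x) uncons_rVK.
have mcons (D : set 'rV[R]_n.+1) : compact D -> measurable (cons_rV (n:=n) @^-1` D).
  by move=> cD; rewrite -[X in measurable X]setTI; apply: measurable_cons_rV => //; exact: measurable_compact_rV.
pose V D s := volume (sl D s).
have xsE D s : xsection (cons_rV (n:=n) @^-1` D) s = sl D s.
  by apply/seteqP; split=> y; rewrite /xsection/= inE.
have mV D : compact D -> measurable_fun [set: measurableTypeR R] (V D : measurableTypeR R -> measurableTypeR R).
  move=> cD; apply/measurable_EFinP.
  have := measurable_fun_xsection (@lebesgue_rV R n) (mcons D cD).
  by congr measurable_fun; apply/funext => s; rewrite /= xsE lebesgue_rV_compact//; exact: csl.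
have intV D : compact D -> ((volume D)%:E = \int[@lebesgue_measure R]_s (V D s)%:E)%E.
  move=> cD; rewrite -lebesgue_rV_compact//= /lebesgue_rV_step /pushforward /product_measure1.
  by apply: eq_integral => s _; rewrite /= xsE lebesgue_rV_compact//; exact: csl.
have supp D : compact D -> exists2 r, 0 < r & forall s, (0 < V D s) -> `|s| <= r.
  move=> /compact_bounded/bounded_sub_cube[r r0 Dr]; exists r => // s Vs.
  have [D0|/set0P[y Dy]] := eqVneq (sl D s) set0.
    by move: Vs; rewrite /V D0 /volume measure0 ltxx.
  by have := Dr _ Dy ord0; rewrite cons_rV0 mxE subr0.
have Vub D : compact D -> has_ubound (range (V D)).
  move=> cD; have [r r0 Dr] := bounded_sub_cube (compact_bounded cD).
  exists ((2 * r) ^+ n) => _ [s _ <-].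
  rewrite -lee_fin -lebesgue_rV_compact; last exact: csl.
  rewrite -(@lebesgue_rV_cube _ _ 0)//; apply: le_measure; rewrite ?inE//.
  - by apply: measurable_compact_rV; exact: csl.
  - exact: measurable_cube.
  - by move=> y Dy i; have := Dr _ Dy (lift ord0 i); rewrite cons_rVS !mxE.
have Vsup D : compact D -> has_sup (range (V D)).
  by move=> cD; split; [exists (V D 0), 0|exact: Vub].
have supgt D : compact D -> volume D != 0 -> 0 < sup (range (V D)).
  move=> cD D0; rewrite ltNge; apply/negP => s0; move/eqP: D0; apply.
  apply: EFin_inj; rewrite intV//; apply: integral0_eq => s _.
  congr EFin; apply/eqP; rewrite eq_le volume_ge0 andbT (le_trans _ s0)//.
  by apply: ub_le_sup; [exact: Vub|exists s].
have supex D : compact D -> forall t, t < sup (range (V D)) -> exists s, t < V D s.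
  move=> cD t ts; have := sup_adherent (_ : 0 < sup (range (V D)) - t) (Vsup D cD).
  by rewrite subr_gt0 => /(_ ts)[_ [s _ <-]]; rewrite subKr => ?; exists s.
set a := sup (range (V A)); set b := sup (range (V B)).
have [rA rA0 hA] := supp _ cA; have [rB rB0 hB] := supp _ cB.
have a0 : 0 < a by exact: supgt.
have b0 : 0 < b by exact: supgt.
have := @prekopa_leindler R l (V A) (V B) (V C) a b (Num.max rA rB) l0 l1 a0 b0
  (mV _ cA) (mV _ cB) (mV _ cC) (fun=> volume_ge0 _) (fun=> volume_ge0 _) (fun=> volume_ge0 _).
have VA s : V A s <= a by apply: ub_le_sup; [exact: Vub|exists s].
have VB s : V B s <= b by apply: ub_le_sup; [exact: Vub|exists s].
move=> /(_ VA VB (supex _ cA) (supex _ cB)).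
have h1 s : 0 < V A s -> `|s| <= Num.max rA rB by move=> /hA h; rewrite le_max h.
have h2 s : 0 < V B s -> `|s| <= Num.max rA rB by move=> /hB h; rewrite le_max h orbT.
move=> /(_ h1 h2); set c := _ `^ _ * _.
have c0 : 0 < c by rewrite mulr_gt0// powR_gt0.
have addE k (v w : 'rV[R]_k) i : (v + w) ord0 i = v ord0 i + w ord0 i by rewrite mxE.
have scaleE k e (v : 'rV[R]_k) i : (e *: v) ord0 i = e * v ord0 i by rewrite mxE.
have h3 s u : V A s `^ (1 - l) * V B u `^ l <= V C ((1 - l) * s + l * u).
  apply: IH; try exact: csl.
  move=> x y Ax By; have := ABC _ _ Ax By; rewrite /sl /=; congr C.
  apply/rowP => i; have [j ->|->] := unliftP ord0 i.
    by rewrite addE !scaleE !cons_rVS addE !scaleE.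
  by rewrite addE !scaleE !cons_rV0.
move=> /(_ h3).
have idiv D e : compact D -> 0 < e ->
    (\int[@lebesgue_measure R]_s (V D s / e)%:E = (volume D / e)%:E)%E.
  move=> cD e0; rewrite mulrC EFinM intV// -ge0_integralZl//.
  - by apply: eq_integral => s _; rewrite mulrC.
  - by apply/measurable_EFinP; exact: mV.
  - by move=> s _; rewrite lee_fin volume_ge0.
  - by rewrite lee_fin invr_ge0 ltW.
rewrite !idiv// -!EFinM -EFinD lee_fin ler_pdivlMr// => H.
apply: le_trans H; rewrite -ler_pdivrMr//.
(* The powers of [a] and [b] produced here multiply to [c], so the normalisation cancels. *)
have := @weighted_AGM R (volume A / a) (volume B / b) l l0 l1.
rewrite !divr_ge0 ?volume_ge0 ?(ltW a0) ?(ltW b0)// => /(_ isT isT); apply: le_trans.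
have inv_pow (x p : R) : 0 < x -> x^-1 `^ p = (x `^ p)^-1.
  by move=> x0; rewrite -powR_inv1 ?ltW// powRAC powR_inv1// powR_ge0.
rewrite !powRM ?volume_ge0 ?invr_ge0 ?(ltW a0) ?(ltW b0)// !inv_pow//.
by rewrite mulrACA -invfM.
Qed.

(** * Comparison of volumes *)

(** A mean value bound: on [0, x] the derivative of the power is largest at the right end.
    [exprD_ge] is the tangent bound from below. *)
Lemma exprD1_le (R : realType) (x : R) m : 0 <= x ->
  (1 + x) ^+ m.+1 <= 1 + m.+1%:R * x * (1 + x) ^+ m.
Proof.
move=> x0; elim: m => [|m IH]; first by rewrite expr1 expr0 !mulr1 mul1r.
have h : 1 <= (1 + x) ^+ m.+1 by rewrite exprn_ege1// lerDl.
have p : 0 <= (1 + x) ^+ m by rewrite exprn_ge0// addr_ge0.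
rewrite [leLHS]exprS mulrDl mul1r.
rewrite (_ : m.+2%:R = m.+1%:R + 1); last by rewrite -natr1.
have q : 0 <= m.+1%:R * x * (1 + x) ^+ m by rewrite !mulr_ge0.
have r : m.+1%:R * x * (1 + x) ^+ m <= m.+1%:R * x * (1 + x) ^+ m.+1.
  by rewrite ler_wpM2l ?mulr_ge0// exprS ler_peMl// lerDl.
lra.
Qed.

Lemma exprD_ge (R : realType) (k y : R) m : 0 <= k -> 0 <= y ->
  k ^+ m.+1 + m.+1%:R * k ^+ m * y <= (k + y) ^+ m.+1.
Proof.
move=> k0 y0; elim: m => [|m IH]; first by rewrite !expr1 expr0 !mulr1 mul1r.
rewrite [leRHS]exprS; have ky : 0 <= k + y by rewrite addr_ge0.
apply: le_trans (ler_wpM2l ky IH).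
rewrite (_ : m.+2%:R = m.+1%:R + 1); last by rewrite -natr1.
have p : 0 <= m.+1%:R * k ^+ m * y * y by rewrite !mulr_ge0// exprn_ge0.
rewrite !exprS -subr_ge0 [X in 0 <= X](_ : _ = m.+1%:R * k ^+ m * y * y)//; ring.
Qed.

(** The limit as [s] tends to 0, made quantitative: for [0 <= s <= 1] the convex function
    [(1 + s * c) ^+ m] lies below its chord [1 + s * (M - 1)]. *)
Lemma ler_expr_limit (R : realType) (X Y c : R) m : 0 <= c -> 0 <= Y ->
  (forall s, 0 < s -> X <= (1 + s * c) ^+ m * Y) -> X <= Y.
Proof.
move=> c0 Y0 H; set M := (1 + c) ^+ m.
have M0 : 0 <= M by rewrite exprn_ge0// addr_ge0.
have hM s : 0 <= s -> s <= 1 -> (1 + s * c) ^+ m <= 1 + s * M.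
  move=> s0 s1; have : (1 + s * c) ^+ m <= 1 + s * (M - 1); last by nra.
  rewrite /M; elim: m {H M M0} => [|m IH]; first by rewrite !expr0 subrr mulr0 addr0.
  have p : 1 <= (1 + c) ^+ m by rewrite exprn_ege1// lerDl.
  have sc : 0 <= 1 + s * c by rewrite addr_ge0// mulr_ge0.
  rewrite !exprS; apply: (le_trans (ler_wpM2l sc IH)).
  rewrite -subr_ge0 [X in 0 <= X](_ : _ = s * (1 - s) * c * ((1 + c) ^+ m - 1)); last by ring.
  by rewrite !mulr_ge0// subr_ge0.
apply/ler_addgt0Pr => e e0.
(* The added 1 keeps the denominator positive when [Y = 0]. *)
pose s := Num.min 1 (e / (M * Y + 1)).
have d0 : 0 < M * Y + 1 by rewrite ltr_wpDl// mulr_ge0.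
have s0 : 0 < s by rewrite lt_min ltr01 divr_gt0.
have s1 : s <= 1 by rewrite ge_min lexx.
have s2 : s * (M * Y + 1) <= e by rewrite -ler_pdivlMr// ge_min lexx orbT.
apply: (le_trans (H s s0)); apply: (le_trans (ler_wpM2r Y0 (hM s (ltW s0) s1))); nra.
Qed.

(** The additive form follows from the multiplicative one: scale both bodies to volume 1 and weight
    them by their radii, [l = d / (k + d)], so that their combination is K + D scaled by 1/(k +
    d). *)
Lemma volume_minkowski_sum_ge (R : realType) m (K D : set 'rV[R]_m.+1) (k d : R) :
  compact K -> compact D -> 0 < k -> 0 < d ->
  volume K = k ^+ m.+1 -> volume D = d ^+ m.+1 ->
  (k + d) ^+ m.+1 <= volume (minkowski_sum K D).
Proof.
move=> cK cD k0 d0 volK volD.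
have kd0 : 0 < k + d by rewrite addr_gt0.
have cC : compact (minkowski_sum K D) by exact: compact_minkowski_sum.
pose l := d / (k + d).
have l0 : 0 < l by rewrite divr_gt0.
have l1 : l < 1 by rewrite ltr_pdivrMr// mul1r ltrDr.
have vol1 (A : set 'rV[R]_m.+1) a : 0 < a -> compact A -> volume A = a ^+ m.+1 -> volume (dilate a^-1 A) = 1.
  move=> a0 cA vA; rewrite volume_dilate ?invr_gt0// vA. by rewrite -exprMn mulVf ?gt_eqF// expr1n.
have := @brunn_minkowski R m.+1 l (dilate k^-1 K) (dilate d^-1 D)
  (dilate (k + d)^-1 (minkowski_sum K D)) l0 l1
  (compact_dilate cK) (compact_dilate cD) (compact_dilate cC).
rewrite (vol1 K k)// (vol1 D d)// !powR1 mulr1 volume_dilate ?invr_gt0// exprVn ler_pdivlMl ?exprn_gt0// mulr1.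
apply=> _ _ [x Kx <-] [y Dy <-]; exists (x + y); first by exists x => //; exists y.
rewrite !scalerA scalerDr; congr (_ *: _ + _ *: _).
  by rewrite /l; field; rewrite !gt_eqF.
by rewrite /l; field; rewrite !gt_eqF.
Qed.

(** * Dilates of symmetric convex bodies *)

Section symmetric_bodies.
Context (R : realType) (n : nat).
Implicit Types K D : set 'rV[R]_n.

(** Membership in a dilate replaces a bound on the gauge of [K]; this is its triangle inequality. *)
Lemma dilateD K (a b : R) x y : convex_set K -> 0 <= a -> 0 <= b ->
  dilate a K x -> dilate b K y -> dilate (a + b) K (x + y).
Proof.
move=> /convex_setP vK a0 b0 [u Ku <-] [v Kv <-].
have [ab|ab] := eqVneq (a + b) 0.
  move/eqP: (ab); rewrite paddr_eq0// => /andP[/eqP -> /eqP ->].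
  by exists u => //; rewrite !add0r !scale0r addr0.
have ab0 : 0 < a + b by rewrite lt_def ab addr_ge0.
exists ((a / (a + b)) *: u + (1 - a / (a + b)) *: v).
  by apply: vK => //; [rewrite divr_ge0// ltW|rewrite ler_pdivrMr// mul1r lerDl].
rewrite scalerDr !scalerA; congr (_ *: _ + _ *: _); field => //.
Qed.

Lemma origin_symmetricN K x : origin_symmetric K -> K x -> K (- x).
Proof. by move=> sK Kx; rewrite sK; exists x. Qed.

(** A point [y] is the midpoint of [c + 2 *: y] and [- c]; hence half the radius of a ball around
    [c]. *)
Lemma interior0 K : convex_body K -> origin_symmetric K ->
  exists2 r, 0 < r & ball 0 r `<=` K.
Proof.
move=> [_ /convex_setP vK [c /nbhs_ballP[r /= r0 cr]]] sK.
exists (r / 2); first by rewrite divr_gt0.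
move=> y [_ y0].
have Kc : K (- c) by apply: origin_symmetricN => //; apply: cr; exact: ballxx.
have Kcy : K (c + 2 *: y).
  apply: cr; split => // i j; rewrite ord1 /ball/= !mxE.
  have := y0 ord0 j; rewrite /ball/= mxE sub0r normrN => yj.
  by rewrite opprD addrA subrr sub0r normrN normrM ger0_norm// -ltr_pdivlMl// mulrC.
rewrite (_ : y = 2^-1 *: (c + 2 *: y) + (1 - 2^-1) *: - c).
  by apply: vK => //; rewrite ?invr_ge0// invf_le1// ler1n.
by apply/rowP => i; rewrite !mxE; field.
Qed.

Lemma body0 K : convex_body K -> origin_symmetric K -> K 0.
Proof. by move=> bK sK; have [r r0 rK] := interior0 bK sK; apply: rK; exact: ballxx. Qed.

Lemma dilate_balanced K a t x : convex_set K -> origin_symmetric K -> K 0 -> `|t| <= 1 ->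
  dilate a K x -> dilate a K (t *: x).
Proof.
move=> /convex_setP vK sK K0 t1 [y Ky <-]; exists (t *: y); last by rewrite !scalerA mulrC.
have h z u : 0 <= u -> u <= 1 -> K z -> K (u *: z).
  move=> u0 u1 Kz; have := vK _ _ u u0 u1 Kz K0; by rewrite scaler0 addr0.
have [t0|t0] := leP 0 t; first by apply: h => //; rewrite -(ger0_norm t0).
rewrite -[t]opprK scaleNr -scalerN; apply: h.
- by rewrite oppr_ge0 ltW.
- by rewrite -(ltr0_norm t0).
- exact: origin_symmetricN.
Qed.

Lemma le_dilate K a b : convex_set K -> K 0 -> 0 <= a -> a <= b -> dilate a K `<=` dilate b K.
Proof.
move=> vK K0 a0 ab x ax.
have b0 : dilate (b - a) K 0 by exists 0; rewrite ?scaler0.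
have := dilateD vK a0 _ ax b0; rewrite subr_ge0 addrC subrK addr0; exact.
Qed.

Lemma absorbing K (vs : seq 'rV[R]_n) : convex_body K -> origin_symmetric K ->
  exists2 c, 0 < c & {in vs, forall v, dilate c K v}.
Proof.
move=> bK sK; have [r r0 rK] := interior0 bK sK; have K0 := body0 bK sK.
have [_ vK _] := bK.
elim: vs => [|v vs [c c0 Hc]]; first by exists 1.
pose a := (`|v| + 1) / r.
have a0 : 0 < a by rewrite divr_gt0// ltr_wpDl.
exists (c + a); first by rewrite addr_gt0.
move=> w; rewrite inE => /orP[/eqP ->|/Hc]; last first.
  by apply: le_dilate => //; rewrite ?ltW// ltrDl.
suff : dilate a K v by apply: le_dilate => //; rewrite ?ltW// ltrDr.
exists (a^-1 *: v); last by rewrite scalerKV ?gt_eqF.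
apply: rK; rewrite -ball_normE /ball_ /= sub0r normrN normrZ gtr0_norm ?invr_gt0//.
by rewrite ltr_pdivrMl// /a divfK ?gt_eqF// ltrDl.
Qed.

Lemma zono_sub_dilate K (vs : seq 'rV[R]_n) c : convex_set K -> origin_symmetric K -> K 0 ->
  0 <= c -> {in vs, forall v, dilate c K v} ->
  zono K vs `<=` dilate (1 + (size vs)%:R * c) K.
Proof.
move=> vK sK K0 c0; elim: vs => [|v vs IH] Hc /=.
  by move=> x Kx; exists x => //; rewrite mul0r addr0 scale1r.
move=> _ [x [t [Zx t1 ->]]]; rewrite -natr1 mulrDl mul1r addrA; apply: dilateD => //.
- by rewrite addr_ge0// mulr_ge0.
- by apply: IH => // w ws; apply: Hc; rewrite inE ws orbT.
- by apply: dilate_balanced => //; apply: Hc; rewrite inE eqxx.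
Qed.

End symmetric_bodies.

(** With Z the zonotope of [vs], [G L] is [m.+1] times the mixed volume V(L, ..., L, Z). It is
    bounded above for L = D because Z lies in [dilate rho D], and below for L = K by Minkowski's
    first inequality because Z contains [D]. The projections compare [G K] with [G D]. *)
Lemma shephard_zonotope (R : realType) m (K D : set 'rV[R]_m.+1) (vs : seq 'rV[R]_m.+1)
    (rho del k d : R) :
  convex_body K -> origin_symmetric K -> convex_body D -> origin_symmetric D ->
  0 <= rho -> 0 <= del ->
  D `<=` zono [set 0] vs -> zono [set 0] vs `<=` dilate rho D ->
  (forall xi, sphere xi ->
    projection_function K xi <= (1 + del) * projection_function D xi) ->
  0 < k -> 0 < d -> volume K = k ^+ m.+1 -> volume D = d ^+ m.+1 ->
  k ^+ m * d <= (1 + del) * rho * d ^+ m.+1.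
Proof.
move=> bK sK bD sD rho0 del0 DZ ZD PKD k0 d0 volK volD.
have [cK vK _] := bK; have [cD vD _] := bD.
have [c c0 Hc] := absorbing vs bK sK.
pose G L := \sum_(v <- vs) seg_gain L v.
have G0 L : 0 <= G L by apply: sumr_ge0 => v _; exact: seg_gain_ge0.
have GKD : G K <= (1 + del) * G D.
  rewrite /G mulr_sumr; apply: ler_sum => v _; rewrite /seg_gain.
  case: eqVneq => [_|v0]; first by rewrite mulr0.
  rewrite mulrCA ler_wpM2l ?mulr_ge0 ?enorm_ge0//; apply: PKD; exact: unit_dirP.
have Gs L s : 0 < s -> \sum_(v <- [seq s *: v | v <- vs]) seg_gain L v = s * G L.
  by move=> s0; rewrite big_map /G mulr_sumr; apply: eq_bigr => v _; rewrite seg_gainZ.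
(* First order in [s] of the inclusion of D + sZ in [dilate (1 + s * rho) D]. *)
have GD : G D <= m.+1%:R * rho * d ^+ m.+1.
  apply: (@ler_expr_limit _ _ _ rho m) => //; first by rewrite !mulr_ge0// exprn_ge0// ltW.
  move=> s s0; rewrite -(ler_pM2l s0).
  have rs0 : 0 < 1 + s * rho by rewrite ltr_pwDl// mulr_ge0// ltW.
  have := volume_zono_ge [seq s *: v | v <- vs] cD vD.
  have : volume (zono D [seq s *: v | v <- vs]) <= volume (dilate (1 + s * rho) D).
    apply: le_volume; [exact: compact_zono|exact: compact_dilate|].
    rewrite zonoE zono_dilate => _ [x Dx [_ [z /ZD[y Dy <-] <-] <-]].
    apply: dilateD => //; first by rewrite mulr_ge0// ltW.
      by exists x => //; rewrite scale1r.
    by exists y => //; rewrite scalerA.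
  rewrite volume_dilate// Gs// volD => h1 h2.
  have := @exprD1_le R (s * rho) m (mulr_ge0 (ltW s0) rho0).
  move=> /(ler_wpM2r (exprn_ge0 m.+1 (ltW d0))) h3.
  apply: (@le_trans _ _ ((1 + s * rho) ^+ m.+1 * d ^+ m.+1 - d ^+ m.+1)); first by lra.
  rewrite lerBlDr (le_trans h3)//; lra.
(* First order in [s] of the chain [(k + s * d) ^+ m.+1] <= |K + sD| <= |K + sZ|, whose last volume
   is bounded through [G K]. *)
have main : m.+1%:R * (k ^+ m * d) <= (1 + del) * G D.
  apply: (@ler_expr_limit _ _ _ ((size vs)%:R * c) m) => //.
  - by rewrite mulr_ge0// ltW.
  - by rewrite mulr_ge0// addr_ge0.
  move=> s s0; rewrite -(ler_pM2l s0).
  have b0 : 0 < 1 + s * ((size vs)%:R * c) by rewrite ltr_pwDl// !mulr_ge0// ltW.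
  have cs : {in [seq s *: v | v <- vs], forall v, dilate (s * c) K v}.
    move=> _ /mapP[v /Hc [x Kx <-] ->]; exists x => //; by rewrite scalerA.
  have := zono_sub_dilate vK sK (body0 bK sK) (mulr_ge0 (ltW s0) (ltW c0)) cs.
  rewrite size_map mulrCA => sub.
  have := volume_zono_le cK vK b0 sub; rewrite Gs// volK => h1.
  have sd0 : 0 < s * d by rewrite mulr_gt0.
  have cs' : compact (dilate s D) by exact: compact_dilate.
  have h2 : (k + s * d) ^+ m.+1 <= volume (minkowski_sum K (dilate s D)).
    by apply: volume_minkowski_sum_ge => //; rewrite volume_dilate// volD exprMn.
  have h3 : volume (minkowski_sum K (dilate s D)) <= volume (zono K [seq s *: v | v <- vs]).
    apply: le_volume; [exact: compact_minkowski_sum|exact: compact_zono|].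
    rewrite zonoE zono_dilate => _ [x Kx [_ [y /DZ Zy <-] <-]].
    by exists x => //; exists (s *: y) => //; exists y.
  have h4 := exprD_ge m (ltW k0) (ltW sd0).
  have h5 : (1 + s * ((size vs)%:R * c)) ^+ m * (s * G K) <=
    (1 + s * ((size vs)%:R * c)) ^+ m * (s * ((1 + del) * G D)).
    by apply: ler_wpM2l; [rewrite exprn_ge0// ltW|rewrite ler_pM2l].
  rewrite [leRHS]mulrCA; lra.
rewrite -(ler_pM2l (ltr0Sn R m)) (le_trans main)//.
apply: (le_trans (ler_wpM2l _ GD)); first by rewrite addr_ge0.
by rewrite le_eqVlt; apply/orP; left; apply/eqP; ring.
Qed.

(** * Polytopes and zonotopes *)

Section affine_family.
Context (R : realType) (N : nat) (c e : 'I_N -> R) (kap : R).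
Hypothesis kap0 : 0 < kap.

Let f i t := c i * t + e i.

(** The trace of [boundary_cell] on a line, see [lineE]: the maximum of the affine functions lies in
    (1 - kap, 1] and [i] is the first index attaining it. *)
Definition ring_cell (c e : 'I_N -> R) i : set (measurableTypeR R) :=
  [set t : R | [/\ 1 - kap < c i * t + e i, c i * t + e i <= 1,
    (forall j, c j * t + e j <= c i * t + e i) &
    (forall j : 'I_N, (j < i)%N -> c j * t + e j < c i * t + e i)]].

Hypothesis mcell : forall i, measurable (ring_cell c e i).

(** The values taken on the cell of [i], written as a preimage under the inverse affine map for
    measurability. Only cells of positive slope count here; the others are reached by reversing the
    line. *)
Let img i : set (measurableTypeR R) :=
  if 0 < c i then (fun u : R => (c i)^-1 * u + (- e i / c i)) @^-1` ring_cell c e i else set0.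

Let mimg i : measurable (img i).
Proof.
have mf (x y : R) : measurable_fun [set: measurableTypeR R] (fun t : R => x * t + y : measurableTypeR R).
  by apply: measurable_funD => //; exact: measurable_funM.
rewrite /img; case: ifP => _ //; rewrite -[X in measurable X]setTI; exact: mf.
Qed.

Let imgP i u : img i u -> 0 < c i /\ ring_cell c e i ((u - e i) / c i).
Proof.
rewrite /img; case: ifP => // ci /=; rewrite (_ : _ + _ = (u - e i) / c i)//.
by rewrite mulrBl mulNr mulrC.
Qed.

Let imgV i u : 0 < c i -> ring_cell c e i ((u - e i) / c i) -> img i u.
Proof.
rewrite /img => ci; rewrite ci /= (_ : (u - e i) / c i = (c i)^-1 * u + - e i / c i)//.
by rewrite mulrBl mulNr mulrC.
Qed.

Let fimg i u : 0 < c i -> c i * ((u - e i) / c i) + e i = u.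
Proof. by move=> ci; field; rewrite gt_eqF. Qed.

Let measure_img i : 0 < c i ->
  lebesgue_measure (img i) = ((c i)%:E * lebesgue_measure (ring_cell c e i))%E.
Proof.
move=> ci; rewrite (lebesgue_measure_affine (e i) ci (mimg i)); congr (_ * lebesgue_measure _)%E.
apply/seteqP; split=> t /=.
  by move=> /imgP[_]; rewrite addrK mulrC mulKf ?gt_eqF.
by move=> h; apply: imgV => //; rewrite addrK mulrC mulKf ?gt_eqF.
Qed.

(** If the maximum equals [u] at [t] and at [t'], with positive slope at each, then maximality
    forces [t = t'], and the rule of the first maximiser forces [i = j]. *)
Let triv_img : trivIset setT img.
Proof.
apply/trivIsetP => i j _ _ ij; apply/seteqP; split=> // u [/imgP[ci Ri] /imgP[cj Rj]].
move: Ri Rj; rewrite /ring_cell /= !fimg// => -[_ _ Mi Fi] [_ _ Mj Fj].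
set t := (u - e i) / c i in Mi Fi *; set t' := (u - e j) / c j in Mj Fj *.
have fi : c i * t + e i = u by exact: fimg.
have fj : c j * t' + e j = u by exact: fimg.
have h1 : t' <= t by rewrite -(ler_pM2l ci) -(lerD2r (e i)) fi; exact: Mj.
have h2 : t <= t' by rewrite -(ler_pM2l cj) -(lerD2r (e j)) fj; exact: Mi.
have tt : t = t' by apply/eqP; rewrite eq_le h1 h2.
have [ij'|ij'|/val_inj ij'] := ltngtP i j.
- by have := Fj _ ij'; rewrite -tt fi ltxx.
- by have := Fi _ ij'; rewrite tt fj ltxx.
- by rewrite ij' eqxx in ij.
Qed.

Let sum_img : (\sum_(i < N | (0 < c i)%R) (c i)%:E * lebesgue_measure (ring_cell c e i) =
  lebesgue_measure (\bigcup_i img i))%E.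
Proof.
have -> : \bigcup_i img i = \big[setU/set0]_(i < N | xpredT i) img i.
  rewrite -bigcup_seq; congr bigcup; apply/seteqP; split=> i //= _.
  by rewrite mem_index_enum.
rewrite measure_bigsetU_ord// (big_mkcond (fun i => 0 < c i)).
by apply: eq_bigr => i _; case: ifP => ci; [exact/esym/measure_img|rewrite /img ci measure0].
Qed.

(** The images are disjoint parts of (1 - kap, 1], and the image of a cell is longer than the cell
    by the factor [c i]. *)
Lemma ring_cell_pos_le :
  (\sum_(i < N | (0 < c i)%R) (c i)%:E * lebesgue_measure (ring_cell c e i) <= kap%:E)%E.
Proof.
rewrite sum_img; apply: (@le_trans _ _ (lebesgue_measure (`]1 - kap, 1]%classic : set R))).
  apply: le_measure; rewrite ?inE//; first by apply: fin_bigcup_measurable.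
  move=> u [i _ /imgP[ci]]; rewrite /ring_cell /= fimg// => -[h1 h2 _ _].
  by rewrite in_itv/= h1.
rewrite lebesgue_measure_itv/= lte_fin ltrBlDr ltrDl kap0.
by rewrite -EFinB lee_fin subKr.
Qed.

(** Starting at [t1], where the maximum is at most 1 - kap, and moving right, the maximum reaches
    every value of (1 - kap, 1], so the images cover this interval. *)
Lemma ring_cell_pos_ge t1 i0 : (forall j, c j * t1 + e j <= 1 - kap) -> 0 < c i0 ->
  (kap%:E <= \sum_(i < N | (0 < c i)%R) (c i)%:E * lebesgue_measure (ring_cell c e i))%E.
Proof.
move=> ft1 ci0.
rewrite sum_img; apply: (@le_trans _ _ (lebesgue_measure (`]1 - kap, 1]%classic : set R))).
  by rewrite lebesgue_measure_itv/= lte_fin ltrBlDr ltrDl kap0 -EFinB lee_fin subKr.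
apply: le_measure; rewrite ?inE//; first by apply: fin_bigcup_measurable.
move=> u /=; rewrite in_itv/= => /andP[u1 u2].
(* The maximum first reaches [u] at the least of these times. Functions of nonpositive slope are
   still below [u] there, since they were at [t1]. *)
pose tau i := (u - e i) / c i.
case: (@arg_minP _ R _ i0 (fun i => 0 < c i) tau ci0) => i ci imin.
set t := tau i in imin.
have fi : c i * t + e i = u by exact: fimg.
have tt1 : t1 < t by rewrite /t /tau ltr_pdivlMr// mulrC; have := ft1 i; lra.
have fneg j : c j <= 0 -> c j * t + e j < u by move=> cj; have := ft1 j; nra.
have fle j : c j * t + e j <= u.
  have [cj|cj] := ltP 0 (c j); last exact/ltW/fneg.
  by have := imin j cj; rewrite /tau ler_pdivlMr// => h; nra.
(* Among the functions equal to [u] at [t], the smallest index is the one whose cell contains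
   [t]. *)
case: (@arg_minnP _ i (fun j => c j * t + e j == u) (fun j => j : nat)).
  by rewrite fi.
move=> k /eqP fk kmin.
have ck : 0 < c k by rewrite ltNge; apply/negP => /fneg; rewrite fk ltxx.
exists k => //; apply: imgV => //.
have -> : (u - e k) / c k = t by rewrite -fk addrK mulrC mulKf ?gt_eqF.
rewrite /ring_cell /= fk; split=> // j jk; rewrite lt_neqAle fle andbT.
by apply/negP => /kmin; rewrite leqNgt jk.
Qed.

End affine_family.


(** * Projections of a polytope read off a thin shell inside its boundary *)

Section polytope_shadow.
Context (R : realType) (m N : nat) (a : 'I_N -> 'rV[R]_m.+1) (kap : R).
Hypotheses (kap0 : 0 < kap) (kap1 : kap < 1).

Definition polytope : set 'rV[R]_m.+1 := [set x | forall i, dotv x (a i) <= 1].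

Hypothesis cQ : compact polytope.

(** Ties are broken in favour of the first maximiser, so that the cells are
    disjoint. *)
Definition boundary_cell i : set 'rV[R]_m.+1 :=
  [set x | [/\ 1 - kap < dotv x (a i), dotv x (a i) <= 1,
    (forall j, dotv x (a j) <= dotv x (a i)) &
    (forall j : 'I_N, (j < i)%N -> dotv x (a j) < dotv x (a i))]].

Lemma measurable_boundary_cell i : measurable (boundary_cell i).
Proof.
have mle v (b : R) : measurable [set x : 'rV[R]_m.+1 | dotv x v <= b].
  rewrite (_ : [set _ | _] = (fun x => dotv x v) @^-1` `]-oo, b]%classic).
    rewrite -[X in measurable X]setTI; apply: measurable_dotv => //; exact: measurable_itv.
  by apply/seteqP; split=> x /=; rewrite in_itv.
have mlt v (b : R) : measurable [set x : 'rV[R]_m.+1 | b < dotv x v].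
  rewrite (_ : [set _ | _] = ~` [set x : 'rV[R]_m.+1 | dotv x v <= b]); first exact: measurableC.
  by apply/seteqP; split=> x /=; [rewrite ltNge => /negP|move/negP; rewrite -ltNge].
rewrite (_ : boundary_cell i = [set x | 1 - kap < dotv x (a i)] `&` [set x | dotv x (a i) <= 1] `&`
   (\bigcap_(j in [set: 'I_N]) [set x | dotv x (a j - a i) <= 0]) `&`
   (\bigcap_(j in [set: 'I_N]) (if (j < i)%N then [set x | 0 < dotv x (a i - a j)] else setT))).
  do 2 (apply: measurableI; [|by apply: fin_bigcap_measurable => // j _; case: ifP]).
  by apply: measurableI.
apply/seteqP; split=> x /=.
  move=> [h1 h2 h3 h4]; split; first split; first by [].
    by move=> j _ /=; rewrite dotvDr dotvNr subr_le0.
  by move=> j _; case: ifP => // /h4; rewrite /= dotvDr dotvNr subr_gt0.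
move=> [[[h1 h2] h3] h4]; split=> // j.
  by have := h3 j I; rewrite /= dotvDr dotvNr subr_le0.
by move=> ji; have := h4 j I; rewrite ji /= dotvDr dotvNr subr_gt0.
Qed.

Lemma boundary_cell_lty i : (lebesgue_rV m.+1 (boundary_cell i) < +oo)%E.
Proof.
apply: (@le_lt_trans _ _ (lebesgue_rV m.+1 polytope)).
  apply: le_measure; rewrite ?inE//; first exact: measurable_boundary_cell.
    exact: measurable_compact_rV.
  by move=> x [_ x1 xi _] j; exact: le_trans (xi j) x1.
by rewrite lebesgue_rV_compact// ltry.
Qed.

Let w i : R := volume (boundary_cell i).

Let wE i : lebesgue_rV m.+1 (boundary_cell i) = (w i)%:E.
Proof. by rewrite /w /volume fineK// ge0_fin_numE// boundary_cell_lty. Qed.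

(** Otherwise the polytope would contain the whole ray from the origin in direction [xi]. *)
Lemma polytope_direction xi : sphere xi -> exists i, 0 < dotv xi (a i).
Proof.
move=> xi1; apply: contrapT => /forallNP H.
have Q0 : polytope 0 by move=> i; rewrite dot0v.
have [p _ pmax] := EVT_max_rV (ex_intro _ 0 Q0) cQ (continuous_subspaceT (@continuous_dotv R _ xi)).
pose t := `|dotv p xi| + 1.
have t0 : 0 <= t by rewrite addr_ge0.
have : polytope (t *: xi).
  by move=> i; rewrite dotvZl (le_trans (mulr_ge0_le0 t0 _))//; have /negP := H i; rewrite -leNgt.
move=> Qt; have := pmax (t *: xi); rewrite inE => /(_ Qt); rewrite dotvZl (xi1 : dotv xi xi = 1) mulr1.
by rewrite leNgt ltr_pwDr// ler_norm.
Qed.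

Section direction.
Variables (xi : 'rV[R]_m.+1) (B : 'M[R]_(m, m.+1)).
Hypotheses (xi1 : sphere xi) (BF : perp_frame (n:=m.+1) xi B).

(** [shadow] for an arbitrary frame: the frame of [xi] also serves [- xi], for which [frame] may
    choose another one. *)
Let sh (K : set 'rV[R]_m.+1) : set 'rV[R]_m := [set y | exists t, K (t *: xi + y *m B)].

Let lineE i y : [set t : R | boundary_cell i (t *: xi + y *m B)] =
  ring_cell kap (fun j => dotv xi (a j)) (fun j => dotv (y *m B) (a j)) i.
Proof.
have E t j : dotv (t *: xi + y *m B) (a j) = dotv xi (a j) * t + dotv (y *m B) (a j).
  by rewrite dotvDl dotvZl mulrC.
by apply/seteqP; split=> t; rewrite /boundary_cell /ring_cell /=;
  (move=> [h1 h2 h3 h4]; split; [move: h1|move: h2|move=> j; move: (h3 j)|move=> j ji; move: (h4 j ji)]);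
  rewrite !E.
Qed.

Let mring y i : measurable (ring_cell kap (fun j => dotv xi (a j)) (fun j => dotv (y *m B) (a j)) i).
Proof. by rewrite -lineE; apply: measurable_line; exact: measurable_boundary_cell. Qed.

Let S : R := \sum_(i < N | 0 < dotv xi (a i)) dotv xi (a i) * w i.

Let SE : (S%:E = \int[lebesgue_rV m]_y
   \sum_(i < N | (0 < dotv xi (a i))%R) (dotv xi (a i))%:E *
     lebesgue_measure (ring_cell kap (fun j => dotv xi (a j)) (fun j => dotv (y *m B) (a j)) i))%E.
Proof.
have mm i : measurable_fun [set: 'rV[R]_m] (fun y => lebesgue_measure
    (ring_cell kap (fun j => dotv xi (a j)) (fun j => dotv (y *m B) (a j)) i)).
  have := measurable_line_measure xi B (measurable_boundary_cell i).
  by congr measurable_fun; apply/funext => y; rewrite /line_measure lineE.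
under eq_integral do rewrite big_mkcond.
rewrite ge0_integral_sum//; last 2 first.
- by move=> i; case: (0 < dotv xi (a i)); [exact: measurable_funeM|exact: measurable_cst].
- by move=> i y _; case: ifP => // ci; rewrite mule_ge0// lee_fin ltW.
rewrite -sumEFin big_mkcond; apply: eq_bigr => i _; case: (boolP (0 < dotv xi (a i))) => ci; last by rewrite integral0.
rewrite ge0_integralZl ?lee_fin ?(ltW ci)// EFinM -wE (lebesgue_rV_fubini xi1 BF); last exact: measurable_boundary_cell.
by congr (_ * _)%E; apply: eq_integral => y _; rewrite /line_measure lineE.
Qed.

Let intE (A : set 'rV[R]_m) : measurable A ->
  (kap%:E * lebesgue_rV m A = \int[lebesgue_rV m]_y (kap%:E * (\1_A y)%:E))%E.
Proof.
move=> mA; rewrite ge0_integralZl ?integral_indic ?setIT// ?lee_fin ?ltW//.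
by apply/measurable_EFinP; exact: measurable_indic.
Qed.

Let mint (A : set 'rV[R]_m) : measurable A ->
  measurable_fun [set: 'rV[R]_m] (fun y => kap%:E * (\1_A y)%:E)%E.
Proof. by move=> mA; apply: measurable_funeM; apply/measurable_EFinP; exact: measurable_indic. Qed.

Let measurable_cell_sum : measurable_fun [set: 'rV[R]_m] (fun y =>
   \sum_(i < N | (0 < dotv xi (a i))%R) (dotv xi (a i))%:E *
     lebesgue_measure (ring_cell kap (fun j => dotv xi (a j)) (fun j => dotv (y *m B) (a j)) i))%E.
Proof.
under eq_fun do rewrite big_mkcond.
apply: emeasurable_sum => i; case: (0 < dotv xi (a i)); last exact: measurable_cst.
apply: measurable_funeM.
have := measurable_line_measure xi B (measurable_boundary_cell i).
by congr measurable_fun; apply/funext => y; rewrite /line_measure lineE.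
Qed.

Let sum_ge0 y : (0 <= \sum_(i < N | (0 < dotv xi (a i))%R) (dotv xi (a i))%:E *
     lebesgue_measure (ring_cell kap (fun j => dotv xi (a j)) (fun j => dotv (y *m B) (a j)) i))%E.
Proof. by apply: sume_ge0 => i ci; rewrite mule_ge0// lee_fin ltW. Qed.

Lemma directional_sum_le : measurable (sh polytope) ->
  (S%:E <= kap%:E * lebesgue_rV m (sh polytope))%E.
Proof.
move=> msh; rewrite SE intE//; apply: ge0_le_integral => //; first exact: mint.
move=> y _; have [ysh|nysh] := pselect (sh polytope y).
  by rewrite indicE mem_set// mule1; apply: ring_cell_pos_le.
rewrite indicE memNset// mule0 big1// => i _.
rewrite (_ : ring_cell _ _ _ _ = set0) ?measure0 ?mule0//.
rewrite -lineE; apply/seteqP; split=> // t [_ x1 xi' _]; apply: nysh.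
by exists t => j; exact: le_trans (xi' j) x1.
Qed.

(** A line that meets the shrunk polytope has a point where the maximum is at most 1 - kap, so it
    crosses the whole shell. *)
Lemma directional_sum_ge : measurable (sh (dilate (1 - kap) polytope)) ->
  (kap%:E * lebesgue_rV m (sh (dilate (1 - kap) polytope)) <= S%:E)%E.
Proof.
move=> msh; rewrite SE intE//; apply: ge0_le_integral => //.
- by move=> y _; rewrite mule_ge0// lee_fin ltW.
- exact: mint.
move=> y _; have [[t1 [x Qx xE]]|nysh] := pselect (sh (dilate (1 - kap) polytope) y); last first.
  by rewrite indicE memNset// mule0.
rewrite indicE mem_set ?mule1; last by exists t1, x.
have [i0 ci0] := polytope_direction xi1.
apply: (ring_cell_pos_ge kap0 (mring y) (t1 := t1) (i0 := i0)) => // j.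
rewrite mulrC -dotvZl -dotvDl -xE dotvZl -[leRHS]mulr1 ler_wpM2l//.
by rewrite subr_ge0 ltW.
Qed.

End direction.

(** The directional bounds for [xi] and [- xi] count the increasing and the decreasing crossings of
    the shell, whence the factor 2. The power of 1 - kap comes from the shadow of the shrunk
    polytope. *)
Lemma polytope_zonotope xi : sphere xi ->
  2 * kap * (1 - kap) ^+ m * projection_function polytope xi <=
  \sum_(i < N) `|dotv xi (a i)| * w i <=
  2 * kap * projection_function polytope xi.
Proof.
move=> xi1; set S := \sum_(i < N) _.
have Nxi1 : sphere (- xi) by rewrite /sphere /= dotvNl dotvNr opprK.
have BF := frameP xi1.
have BFN : perp_frame (n:=m.+1) (- xi) (frame xi).
  by have [? Bx] := BF; split=> //; rewrite linearN /= mulmxN Bx oppr0.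
have shN K : [set y | exists t, K (t *: - xi + y *m frame xi)] = shadow xi K.
  apply/seteqP; split=> y [t Kt]; exists (- t); first by rewrite scaleNr -scalerN.
  by rewrite scalerN scaleNr opprK.
have cQk : compact (dilate (1 - kap) polytope) by exact: compact_dilate.
have csh := @compact_shadow R m xi xi1 polytope cQ.
have cshk := @compact_shadow R m xi xi1 _ cQk.
have p0 : 0 < 1 - kap by rewrite subr_gt0.
have SE : S = \sum_(i < N | 0 < dotv xi (a i)) dotv xi (a i) * w i +
   \sum_(i < N | 0 < dotv (- xi) (a i)) dotv (- xi) (a i) * w i.
  rewrite /S [in RHS]big_mkcond [X in _ + X]big_mkcond -big_split; apply: eq_bigr => i _.
  by rewrite dotvNl oppr_gt0; case: ltrgt0P => [h|h|h]; rewrite ?mul0r /= ?addr0 ?add0r.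
have := directional_sum_le xi1 BF (measurable_compact_rV csh).
have := directional_sum_ge xi1 BF (measurable_compact_rV cshk).
have := directional_sum_le Nxi1 BFN; have := directional_sum_ge Nxi1 BFN.
rewrite !shN => /(_ (measurable_compact_rV cshk)) + /(_ (measurable_compact_rV csh)).
rewrite -/(shadow xi _) -/(shadow xi polytope) !lebesgue_rV_compact// -!EFinM !lee_fin.
rewrite -!projection_functionE// projection_function_dilate// => h1 h2 h3 h4.
by rewrite SE; apply/andP; split; lra.
Qed.

End polytope_shadow.

(** * Approximation of projection bodies by zonotopes *)

Lemma continuous_addr (R : realType) (V : normedModType R) (c : V) :
  continuous (fun z => z + c).
Proof. by move=> z; apply: cvgD; [exact: cvg_id|exact: cvg_cst]. Qed.

Lemma closed_halfspace (R : realType) n (v : 'rV[R]_n) (b : R) :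
  closed [set x : 'rV[R]_n | dotv x v <= b].
Proof.
have /continuous_closedP cv := @continuous_dotv R n v.
by apply: (cv [set t : R | t <= b]); exact: closed_le.
Qed.

(** The compact set [T] surrounds [M] and avoids it, so each of its points is cut off by an open
    half-space [U a] with [a] in the polar body [A]. Finitely many of them cover [T]. *)
Lemma polytope_approx (R : realType) m (M : set 'rV[R]_m.+1) (r kap : R) :
  convex_body M -> 0 < r -> ball 0 r `<=` M -> 0 < kap ->
  exists N, exists a : 'I_N -> 'rV[R]_m.+1,
    M `<=` polytope a /\ polytope a `<=` dilate (1 + kap) M.
Proof.
move=> [cM vM _] r0 rM kap0.
have M0 : M 0 by apply: rM; exact: ballxx.
have kap1 : 0 < 1 + kap by rewrite addr_gt0.
have cM' : compact (dilate (1 + kap) M) by exact: compact_dilate.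
have [b b0 Mb] := bounded_sub_cube (compact_bounded cM').
have normE (x : 'rV[R]_m.+1) c : 0 <= c -> (`|x| <= c) <-> cube 0 c x.
  move=> c0; rewrite [`|x|]mx_normrE; split=> [h i|h].
    rewrite mxE subr0; apply: le_trans h.
    exact: (le_bigmax _ (fun ij : 'I_1 * 'I_m.+1 => `|x ij.1 ij.2|) (ord0, i)).
  by apply: bigmax_le => // -[i j] _ /=; rewrite ord1; have := h j; rewrite mxE subr0.
pose T : set 'rV[R]_m.+1 := [set x | `|x| <= b + 1] `&` ~` (dilate (1 + kap) M)°.
have cT : compact T.
  apply: bounded_closed_compact.
    by exists (b + 1); split; [exact: num_real|move=> x bx y [/= yb _]; rewrite (le_trans yb)// ltW].
  apply: closedI; last by apply: open_closedC; exact: open_interior.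
  have /continuous_closedP cn := @norm_continuous R 'rV[R]_m.+1.
  by apply: (cn [set t : R | t <= b + 1]); exact: closed_le.
(* Around a point of [M], the ball of radius [kap * r] stays in M + kap M, which lies in
   [dilate (1 + kap) M]. *)
have TM x : T x -> ~ M x.
  move=> [_ nx] Mx; apply: nx; apply/nbhs_ballP; exists (kap * r) => /=; first by rewrite mulr_gt0.
  move=> y; rewrite -ball_normE /ball_ /= distrC => xy.
  rewrite -[y](subrK x) [_ + x]addrC; apply: dilateD => //; first exact: ltW.
    by exists x => //; rewrite scale1r.
  exists (kap^-1 *: (y - x)); last by rewrite scalerKV// gt_eqF.
  apply: rM; rewrite -ball_normE /ball_ /= sub0r normrN normrZ gtr0_norm ?invr_gt0//.
  by rewrite ltr_pdivrMl.
pose A : set 'rV[R]_m.+1 := [set a | forall z, M z -> dotv z a <= 1].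
pose U (a : 'rV[R]_m.+1) : set 'rV[R]_m.+1 := [set x | 1 < dotv x a].
have oU a : A a -> open (U a).
  move=> _; rewrite (_ : U a = ~` [set x | dotv x a <= 1]).
    by apply: closed_openC; exact: closed_halfspace.
  by apply/seteqP; split=> x; rewrite /U /=; [rewrite ltNge => /negP|move/negP; rewrite -ltNge].
have TU : T `<=` cover A U.
  move=> x /TM nMx.
  have [th [e [th1 e0 sep]]] := separation cM vM (ex_intro _ 0 M0) nMx.
  (* A level strictly between [M] and [x]; it is positive because the origin lies in [M], so
     dividing by it normalises the half-space. *)
  pose h := dotv x th - e / 2.
  have h0 : 0 < h by have := sep _ M0; rewrite dot0v /h; lra.
  exists (h^-1 *: th).
    by move=> z /sep hz; rewrite dotvZr ler_pdivrMl// mulr1 /h; lra.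
  by rewrite /U /= dotvZr ltr_pdivlMl// mulr1 /h; lra.
move: cT; rewrite compact_cover => /(_ _ A U oU TU)[D' D'A TD'].
pose s : seq 'rV[R]_m.+1 := finmap.enum_fset D'.
exists (size s), (fun i => tnth (in_tuple s) i).
have sA a : a \in s -> A a by move=> sa; have := D'A a sa; rewrite inE.
have tD i : tnth (in_tuple s) i \in s by exact: mem_tnth.
have polD x : polytope (fun i => tnth (in_tuple s) i) x -> forall a, a \in s -> dotv x a <= 1.
  by move=> Qx a aD; have /tnthP[i ->] : a \in in_tuple s by []; exact: Qx.
split=> [z Mz i|]; first exact: (sA _ (tD i)).
have inner x : polytope (fun i => tnth (in_tuple s) i) x -> `|x| <= b + 1 -> dilate (1 + kap) M x.
  move=> /polD Qx xb; apply: contrapT => nx.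
  have : T x by split=> // /interior_subset.
  by move=> /TD'[a /= aD]; rewrite /U /= ltNge (Qx a aD).
(* A point of the polytope of norm above [b + 1] would, shrunk to norm [b + 1], lie in
   [dilate (1 + kap) M] and so in the cube of half-side [b]. *)
move=> x Qx; have [xb|xb] := leP `|x| (b + 1); first exact: inner.
exfalso.
have b1 : 0 < b + 1 by rewrite addr_gt0.
have x0 : 0 < `|x| by exact: lt_trans xb.
pose u := (b + 1) / `|x|.
have u0 : 0 < u by rewrite divr_gt0.
have u1 : u <= 1 by rewrite ler_pdivrMr// mul1r ltW.
have nux : `|u *: x| = b + 1 by rewrite normrZ gtr0_norm// /u divfK// gt_eqF.
have : dilate (1 + kap) M (u *: x).
  apply: inner; last by rewrite nux.
  move=> i; rewrite dotvZl; have := Qx i; nra.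
by move=> /Mb /normE; rewrite nux => /(_ (ltW b0)); lra.
Qed.

Lemma zonotope_approx (R : realType) m (M : set 'rV[R]_m.+1) (s : R) :
  convex_body M -> 0 < s ->
  exists vs, forall xi, sphere xi ->
    projection_function M xi <= zono_support vs xi <= (1 + s) ^+ m * projection_function M xi.
Proof.
move=> [cM vM [c]] /= ci s0.
pose M0 : set 'rV[R]_m.+1 := [set x + - c | x in M].
have cM0 : compact M0.
  by apply: compact_image_rV => //; exact: continuous_addr.
have vM0 : convex_set M0.
  apply/convex_setP => _ _ t t0 t1 [x Mx <-] [y My <-].
  exists (t *: x + (1 - t) *: y); first exact: (convex_setP M).1.
  by apply/rowP => i; rewrite !mxE; ring.
move: ci => /nbhs_ballP[r /= r0 rM].
have rM0 : ball 0 r `<=` M0.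
  move=> x xr; exists (x + c); last by rewrite addrK.
  by apply: rM; move: xr; rewrite -!ball_normE /ball_ /= sub0r opprD addrCA subrr addr0.
have bM0 : convex_body M0.
  by split=> //; exists 0; apply/nbhs_ballP; exists r.
(* The solution of (1 + kap) / (1 - kap) = 1 + s: one factor is lost in the outer polytope, the
   other in the shell. *)
pose kap := s / (2 + s).
have kap0 : 0 < kap by rewrite divr_gt0// addr_gt0.
have kap1 : kap < 1 by rewrite ltr_pdivrMr ?mul1r ?addr_gt0// ltrDr.
have [N [a [MQ QM]]] := polytope_approx bM0 r0 rM0 kap0.
have k1 : 0 < 1 + kap by rewrite addr_gt0.
have k2 : 0 < 1 - kap by rewrite subr_gt0.
have cQ : compact (polytope a).
  have cM' : compact (dilate (1 + kap) M0) by exact: compact_dilate.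
  apply: (subclosed_compact _ cM' QM).
  rewrite (_ : polytope a = \bigcap_(i in [set: 'I_N]) [set x | dotv x (a i) <= 1]).
    by apply: closed_bigI => i _; exact: closed_halfspace.
  by apply/seteqP; split=> x /= H i; [move=> _; exact: H|exact: H].
(* Dividing by the constant of the lower bound in [polytope_zonotope] puts the whole error on the
   upper side. *)
pose w i := volume (boundary_cell a kap i) / (2 * kap * (1 - kap) ^+ m).
exists [seq w i *: a i | i <- index_enum 'I_N] => xi xi1.
have PM0 := projection_function_translate xi1 (- c) cM; rewrite -/M0 in PM0.
rewrite -PM0.
have := polytope_zonotope kap0 kap1 cQ xi1.
have p1 : projection_function M0 xi <= projection_function (polytope a) xi.
  exact: le_projection_function.
have p2 : projection_function (polytope a) xi <= (1 + kap) ^+ m * projection_function M0 xi.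
  rewrite -projection_function_dilate//; apply: le_projection_function => //.
  exact: compact_dilate.
have d0 : 0 < 2 * kap * (1 - kap) ^+ m by apply: mulr_gt0; [exact: mulr_gt0|exact: exprn_gt0].
have -> : zono_support [seq w i *: a i | i <- index_enum 'I_N] xi =
    (\sum_(i < N) `|dotv xi (a i)| * volume (boundary_cell a kap i)) / (2 * kap * (1 - kap) ^+ m).
  rewrite /zono_support big_map mulr_suml; apply: eq_bigr => i _.
  rewrite dotvZl normrM dotvC ger0_norm ?divr_ge0 ?volume_ge0 ?(ltW d0)// /w.
  by rewrite mulrC mulrA.
move=> /andP[h1 h2]; apply/andP; split.
  by rewrite ler_pdivlMr// mulrC (le_trans _ h1)// ler_pM2l.
rewrite ler_pdivrMr// (le_trans h2)//.
have -> : 1 + s = (1 + kap) / (1 - kap).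
  apply: (mulIf (lt0r_neq0 k2)); rewrite divfK ?lt0r_neq0// /kap; field.
  by rewrite lt0r_neq0// addr_gt0.
rewrite exprMn exprVn mulrC mulrA -mulrA.
rewrite (_ : _ * (2 * kap * _) = ((1 + kap) ^+ m * projection_function M0 xi) * (2 * kap)); last first.
  by field; rewrite expf_neq0// gt_eqF.
by rewrite ler_pM2r// mulr_gt0.
Qed.

(** The projection function of [M] is the support function of [D], so [zonotope_approx] compares
    support functions. Separation turns both comparisons into inclusions. *)
Lemma projection_body_zonotope (R : realType) m (M D : set 'rV[R]_m.+1) (s : R) :
  convex_body M -> projection_body_of M D -> 0 < s ->
  exists vs, D `<=` zono [set 0] vs /\ zono [set 0] vs `<=` dilate ((1 + s) ^+ m) D.
Proof.
move=> bM [bD sD hD] s0; have [vs Hvs] := zonotope_approx bM s0.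
have [cD vD _] := bD; have D0 := body0 bD sD.
have ubD xi : has_ubound [set dotv xi y | y in D].
  have [p _ pmax] := EVT_max_rV (ex_intro _ 0 D0) cD (continuous_subspaceT (@continuous_dotv R _ xi)).
  exists (dotv p xi) => _ [y Dy <-]; rewrite dotvC.
  by have := pmax y; rewrite inE; apply.
have cZ : compact (zono [set (0 : 'rV[R]_m.+1)] vs) by apply: compact_zono; exact: compact_set1.
have vZ : convex_set (zono [set (0 : 'rV[R]_m.+1)] vs).
  by apply: convex_zono; apply/convex_setP => x y t _ _ -> ->; rewrite !scaler0 addr0.
have Z0 : zono [set (0 : 'rV[R]_m.+1)] vs 0 by apply: sub_zono.
have rho0 : 0 < (1 + s) ^+ m by rewrite exprn_gt0// addr_gt0.
exists vs; split=> x.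
  move=> Dx; apply: contrapT => nZx.
  have [th [e [th1 e0 sep]]] := separation cZ vZ (ex_intro _ 0 Z0) nZx.
  have [z Zz zE] := zono_support_max vs th.
  have := sep z Zz; rewrite zE; have /andP[+ _] := Hvs _ th1; rewrite -hD// => h1 h2.
  have : dotv x th <= support_function D th.
    by apply: ub_le_sup => //; exists x => //; rewrite dotvC.
  lra.
move=> Zx; apply: contrapT => nDx.
have cD' : compact (dilate ((1 + s) ^+ m) D) by exact: compact_dilate.
have vD' : convex_set (dilate ((1 + s) ^+ m) D).
  apply/convex_setP => _ _ t t0 t1 [u Du <-] [v Dv <-].
  exists (t *: u + (1 - t) *: v); first exact: (convex_setP D).1.
  by apply/rowP => i; rewrite !mxE; ring.
have D0' : dilate ((1 + s) ^+ m) D 0 by exists 0; rewrite ?scaler0.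
have [th [e [th1 e0 sep]]] := separation cD' vD' (ex_intro _ 0 D0') nDx.
have := zono_support_ub th Zx; have /andP[_] := Hvs _ th1; rewrite -hD// => h1 h2.
have : (1 + s) ^+ m * support_function D th <= dotv x th - e.
  rewrite -ler_pdivlMl//; apply: ge_sup; first by exists (dotv th 0), 0.
  move=> _ [y Dy <-]; rewrite ler_pdivlMl// dotvC -dotvZl.
  by have := sep ((1 + s) ^+ m *: y); rewrite lerBrDr; apply; exists y.
lra.
Qed.

(** * Isotropic bodies *)

Lemma isotropic_projection_ge (R : realType) m (E : set 'rV[R]_m.+1) (l : R) xi :
  compact E -> isotropic_with E l -> sphere xi ->
  3 / (16 * l) <= projection_function E xi.
Proof.
move=> cE [volE l0 intE] xi1.
have mE := measurable_compact_rV cE.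
have mf : measurable_fun [set: 'rV[R]_m.+1] (fun x => dotv x xi : measurableTypeR R).
  exact: measurable_dotv.
pose I : set 'rV[R]_m.+1 := (fun x => dotv x xi) @^-1` `[- (2 * l), 2 * l]%classic.
have mI : measurable I.
  by rewrite -[I]setTI; apply: mf => //; exact: measurable_itv.
have mEI : measurable (E `&` I) by exact: measurableI.
have mEN : measurable (E `\` I) by exact: measurableD.
have lE : lebesgue_rV m.+1 E = 1%E by rewrite lebesgue_rV_compact// volE.
(* Chebyshev's inequality at the level [2 * l], which leaves at most a quarter of the volume outside
   the slab. *)
have tail : ((4 * l ^+ 2)%:E * lebesgue_rV m.+1 (E `\` I) <= (l ^+ 2)%:E)%E.
  rewrite -(intE _ xi1).
  rewrite (_ : (_ * _)%E = \int[lebesgue_rV m.+1]_(x in E `\` I) (4 * l ^+ 2)%:E)%E; last first.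
    by rewrite integral_cst.
  have mf2 : measurable_fun E (fun x => (dotv x xi ^+ 2)%:E).
    apply/measurable_EFinP; apply: measurable_funX; apply: measurable_funTS; exact: measurable_dotv.
  apply: (@le_trans _ _ (\int[lebesgue_rV m.+1]_(x in E `\` I) (dotv x xi ^+ 2)%:E)%E).
    apply: ge0_le_integral => //.
    - by move=> x _; rewrite lee_fin mulr_ge0// sqr_ge0.
    - by apply: measurable_funS mf2 => // x [].
    move=> x [Ex nIx]; rewrite lee_fin.
    have : 2 * l <= `|dotv x xi|.
      rewrite leNgt; apply/negP => h; apply: nIx.
      by rewrite /I /= in_itv/= -ler_norml ltW.
    rewrite -[dotv x xi ^+ 2]real_normK ?num_real// => h.
    rewrite (_ : 4 * l ^+ 2 = (2 * l) ^+ 2); last by ring.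
    by rewrite ler_pXn2r// nnegrE// mulr_ge0// ltW.
  by apply: ge0_subset_integral => // x _; rewrite lee_fin sqr_ge0.
have split1 : (lebesgue_rV m.+1 (E `&` I) + lebesgue_rV m.+1 (E `\` I) = 1)%E.
  rewrite -lE -measureU//; first by rewrite -setIUr setUv setIT.
  by apply/seteqP; split=> // x [[_ ?] [_ ?]].
have f1 : lebesgue_rV m.+1 (E `&` I) \is a fin_num.
  rewrite ge0_fin_numE//; apply: (@le_lt_trans _ _ 1%E); last exact: ltry.
  by rewrite -split1 leeDl.
have f2 : lebesgue_rV m.+1 (E `\` I) \is a fin_num.
  rewrite ge0_fin_numE//; apply: (@le_lt_trans _ _ 1%E); last exact: ltry.
  by rewrite -split1 leeDr.
move: tail split1.
(* Lines of direction [xi] meet the slab in length [4 * l], and only those over the shadow meet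
   [E]. *)
have up : (lebesgue_rV m.+1 (E `&` I) <= (4 * l * projection_function E xi)%:E)%E.
  have csh := @compact_shadow R m xi xi1 E cE.
  have msh := measurable_compact_rV csh.
  rewrite projection_functionE// EFinM -lebesgue_rV_compact//.
  rewrite (lebesgue_rV_fubini xi1 (frameP xi1))//.
  have -> : ((4 * l)%:E * lebesgue_rV m (shadow xi E) =
     \int[lebesgue_rV m]_y ((4 * l)%:E * (\1_(shadow xi E) y)%:E))%E.
    rewrite ge0_integralZl ?integral_indic ?setIT// ?lee_fin ?mulr_ge0 ?(ltW l0)//.
    by apply/measurable_EFinP; exact: measurable_indic.
  apply: ge0_le_integral => //.
  - exact: measurable_line_measure.
  - by apply: measurable_funeM; apply/measurable_EFinP; exact: measurable_indic.
  move=> y _; have [ysh|nysh] := pselect (shadow xi E y); last first.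
    rewrite indicE memNset// mule0 /line_measure (_ : [set t | _] = set0) ?measure0//.
    by apply/seteqP; split=> // t [Et _]; apply: nysh; exists t.
  rewrite indicE mem_set// mule1.
  apply: (@le_trans _ _ (lebesgue_measure (`[- (2 * l), 2 * l]%classic : set R))).
    apply: le_measure; rewrite ?inE//; first exact: measurable_line.
    by move=> t [_]; rewrite /I /= dotvDl dotvZl dotv_frame// addr0 (xi1 : dotv xi xi = 1) mulr1.
  rewrite lebesgue_measure_itv/= lte_fin; case: ifP => _; last by rewrite lee_fin mulr_ge0// ltW.
  by rewrite -EFinB lee_fin; lra.
move: up; rewrite -(fineK f1) -(fineK f2).
set u := fine (lebesgue_rV m.+1 (E `&` I)); set v := fine (lebesgue_rV m.+1 (E `\` I)).
rewrite -EFinM -EFinD !lee_fin => up tail [uv].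
have v4 : 4 * v <= 1.
  have l2 : 0 < l ^+ 2 by rewrite exprn_gt0.
  by rewrite -(ler_pM2r l2) mul1r mulrAC.
rewrite ler_pdivrMr ?mulr_gt0//; lra.
Qed.

(** [S] preserves volume, and [x |-> x *m S^T] scales every norm by [l' / l]; so
    [S] is [l' / l] times an orthogonal matrix and [l' / l = 1]. *)
Lemma isotropic_mulmx_unique (R : realType) m (E : set 'rV[R]_m.+1) (S : 'M[R]_m.+1) (l l' : R) :
  compact E -> S \in unitmx -> isotropic_with E l ->
  isotropic_with [set x *m S | x in E] l' -> l' = l.
Proof.
move=> cE uS [volE l0 intE] [volE' l'0 intE'].
have mE := measurable_compact_rV cE.
set E' := [set x *m S | x in E] in volE' intE'.
have cE' : compact E' by apply: compact_image_rV => //; exact: continuous_mulmx.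
have mE' := measurable_compact_rV cE'.
have E'E : [set x | E' (x *m S)] = E.
  by apply/seteqP; split=> x /=; [move=> [y Ey] /(can_inj (mulmxK uS)) <-|exists x].
have lS A : measurable A -> lebesgue_rV m.+1 [set x | A (x *m S)] = lebesgue_rV m.+1 A.
  move=> mA; have := lebesgue_rV_mulmx uS mA mE'.
  by rewrite E'E (lebesgue_rV_compact cE) (lebesgue_rV_compact cE') volE volE' mule1 mul1e.
have change xi : sphere xi ->
    (\int[lebesgue_rV m.+1]_(x in E) ((dotv x (xi *m S^T)) ^+ 2)%:E = (l' ^+ 2)%:E)%E.
  move=> xi1; rewrite -(intE' _ xi1).
  pose nu : {measure set 'rV[R]_m.+1 -> \bar R} :=
    measure_function_pushforward__canonical__measure_function_Measure
      (lebesgue_rV m.+1) (measurable_mulmx S).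
  rewrite [RHS](eq_measure_integral nu); last by move=> A mA _; exact: (esym (lS A mA)).
  have mf : measurable_fun E' (fun y => (dotv y xi ^+ 2)%:E).
    apply/measurable_EFinP; apply: measurable_funX; apply: measurable_funTS; exact: measurable_dotv.
  have f0 : {in E', forall y, (0 <= (dotv y xi ^+ 2)%:E)%E} by move=> y _; rewrite lee_fin sqr_ge0.
  rewrite [RHS](ge0_integral_pushforward (measurable_mulmx S) (lebesgue_rV m.+1) mE' mf f0).
  rewrite (_ : _ @^-1` E' = E); last by rewrite -[in RHS]E'E.
  by apply: eq_integral => x _ /=; rewrite dotv_mulmx.
pose mu := l' / l.
have mu0 : 0 < mu by rewrite divr_gt0.
(* By [change], [l' ^+ 2] is the second moment of [E] along [xi *m S^T], which is [l ^+ 2] times the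
   squared norm of that vector. *)
have form xi : sphere xi -> dotv (xi *m S^T) (xi *m S^T) = mu ^+ 2.
  move=> xi1; have xi0 : xi *m S^T != 0.
    apply/eqP => h; have uST : S^T \in unitmx by rewrite unitmx_tr.
    have : xi = 0 by apply: (can_inj (mulmxK uST)); rewrite h mul0mx.
    by move=> x0; move: xi1; rewrite x0 /sphere /= dot0v => /eqP; rewrite eq_sym oner_eq0.
  have := change _ xi1; rewrite -[in X in X -> _](unit_dirK xi0).
  rewrite (eq_integral (fun x => (enorm (xi *m S^T) ^+ 2)%:E * (dotv x (unit_dir (xi *m S^T)) ^+ 2)%:E)%E); last first.
    by move=> x _; rewrite dotvZr exprMn EFinM.
  rewrite ge0_integralZl//; last 3 first.
  - apply/measurable_EFinP; apply: measurable_funX; apply: measurable_funTS; exact: measurable_dotv.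
  - by move=> x _; rewrite lee_fin sqr_ge0.
  - by rewrite lee_fin sqr_ge0.
  rewrite intE; last exact: unit_dirP.
  rewrite -EFinM sqr_enorm => -[h].
  by rewrite /mu expr_div_n -h mulfK// expf_neq0// gt_eqF.
have form2 x : dotv (x *m S^T) (x *m S^T) = mu ^+ 2 * dotv x x.
  have [->|x0] := eqVneq x 0; first by rewrite mul0mx !dotv0 mulr0.
  have [u u1 <-] : exists2 u, sphere u & enorm x *: u = x.
    by exists (unit_dir x); [exact: unit_dirP|exact: unit_dirK].
  by rewrite -scalemxAl !dotvZl !dotvZr form// (u1 : dotv u u = 1); ring.
have polar x y : dotv (x *m S^T) (y *m S^T) = mu ^+ 2 * dotv x y.
  have := form2 (x + y).
  rewrite mulmxDl !dotvDl !dotvDr !form2 (dotvC (y *m _)) (dotvC y x); lra.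
have SS : S^T *m S = (mu ^+ 2)%:M.
  apply/row_matrixP => i; rewrite !rowE.
  set x := delta_mx _ _.
  have h y : dotv (x *m (S^T *m S)) y = dotv (x *m (mu ^+ 2)%:M) y.
    by rewrite mulmxA dotv_mulmx polar mul_mx_scalar dotvZl.
  apply/eqP; rewrite -subr_eq0 -dotv_eq0 dotvDl dotvNl h subrr //.
have mun0 : mu != 0 by rewrite gt_eqF.
pose O := mu^-1 *: S.
have OO : O *m O^T = 1%:M.
  have : (mu^-2 *: S^T) *m S = 1%:M.
    by rewrite -scalemxAl SS scale_scalar_mx mulVf// expf_neq0.
  move=> /mulmx1C; rewrite -scalemxAr => H.
  by rewrite /O linearZ /= -scalemxAl -scalemxAr scalerA -invfM -expr2 -exprVn exprVn.
(* [S] is [mu] times the orthogonal matrix [O]; its effect on a cube of volume 1 is computed and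
   compared with [lS]. *)
have muE : mu ^+ m.+1 = 1.
  have := lS _ (measurable_cube 0 2^-1).
  have -> : [set x | cube 0 2^-1 (x *m S)] =
     [set x : 'rV[R]_m.+1 | [set y : 'rV[R]_m.+1 | cube 0 2^-1 (mu^-1^-1 *: y)] (x *m O)].
    by apply/funext => x /=; rewrite invrK /O -scalemxAr scalerKV.
  have mui : 0 < mu^-1 by rewrite invr_gt0.
  have msc : measurable [set y : 'rV[R]_m.+1 | cube 0 2^-1 (mu^-1^-1 *: y)].
    by rewrite -[X in measurable X]setTI; apply: measurable_scalerV => //; exact: measurable_cube.
  rewrite lebesgue_rV_orthogonal// lebesgue_rV_scale//; last exact: measurable_cube.
  rewrite lebesgue_rV_cube// divff// expr1n mule1 exprVn => -[h].
  by rewrite -[LHS]invrK h invr1.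
have : mu == 1 by rewrite -(@pexpr_eq1 _ mu m.+1)// ?muE// ltW.
by rewrite /mu => /eqP h; rewrite -[l'](divfK (lt0r_neq0 l0)) h mul1r.
Qed.

(** Whichever [T] realises the chosen constant, the image of [D] under [T] is the image of
    [dilate t D] under [t^-1 *: T], so uniqueness applies. *)
Lemma dilate_isotropic_constant (R : realType) m (D : set 'rV[R]_m.+1) (t l : R) :
  compact D -> 0 < t -> isotropic_with (dilate t D) l -> isotropic_constant D = l.
Proof.
move=> cD t0 iso.
have dE (a : R) : dilate a D = [set x *m a%:M | x in D].
  by congr image; apply/funext => x; rewrite mul_mx_scalar.
have [T uT isoT] : [set l | exists2 T : 'M[R]_m.+1, T \in unitmx &
    isotropic_with [set x *m T | x in D] l] (isotropic_constant D).
  apply: xgetPex; exists l; exists t%:M; last by rewrite -dE.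
  by rewrite unitmxE det_scalar unitfE expf_neq0// gt_eqF.
apply: (@isotropic_mulmx_unique _ _ (dilate t D) (t^-1 *: T)) => //.
- exact: compact_dilate.
- by rewrite unitmxZ// unitfE invr_eq0 gt_eqF.
move: isoT; congr isotropic_with; apply/seteqP; split=> y /=.
  move=> [x Dx <-]; exists (t *: x); first by exists x.
  by rewrite -scalemxAr -scalemxAl scalerA mulVf ?gt_eqF// scale1r.
move=> [_ [x Dx <-] <-]; exists x => //.
by rewrite -scalemxAr -scalemxAl scalerA mulVf ?gt_eqF// scale1r.
Qed.

Theorem proposition1 (R : realType) :
  exists C : R, 0 < C /\
    forall (n : nat) (eps : R) (K D : set 'rV[R]_n),
      (0 < n)%N -> 0 < eps ->
      convex_body K -> origin_symmetric K ->
      convex_body D -> origin_symmetric D ->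
      projection_body D -> dilate_of_isotropic D ->
      (forall xi, sphere xi ->
         projection_function K xi <= projection_function D xi + eps) ->
      volume K `^ ((n%:R - 1) / n%:R) <=
        volume D `^ ((n%:R - 1) / n%:R)
        + C * eps * ln (1 + n%:R) ^+ 2 * isotropic_constant D.
Proof.
have ln2 : 0 < ln (2 : R) by rewrite ln_gt0// ltr1n.
(* The factor 16/3 inverts the bound 3/16 of [isotropic_projection_ge]; the logarithm is smallest at
   [n = 1]. *)
exists (16 / 3 / ln 2 ^+ 2); split; first by rewrite !divr_gt0// exprn_gt0.
move=> [//|m] eps K D _ eps0 bK sK bD sD [M bM DM] [t t0 [l iso]] PKD.
have [cD _ _] := bD.
have -> : isotropic_constant D = l by exact: dilate_isotropic_constant iso.
have [volt l0 _] := iso.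
have root (A : set 'rV[R]_m.+1) : 0 < volume A -> exists2 a, 0 < a &
    volume A = a ^+ m.+1 /\ volume A `^ ((m.+1%:R - 1) / m.+1%:R) = a ^+ m.
  move=> A0; have a0 : 0 < volume A `^ m.+1%:R^-1 by exact: powR_gt0.
  exists (volume A `^ m.+1%:R^-1) => //; split.
    by rewrite -powR_mulrn ?ltW// -powRrM mulVf// powRr1// ltW.
  by rewrite -powR_mulrn ?ltW// -powRrM -natr1 addrK mulrC.
have [k k0 [volK ->]] := root _ (volume_gt0 bK).
have [d d0 [volD ->]] := root _ (volume_gt0 bD).
(* The isotropic dilate has volume 1. *)
have td : t * d = 1.
  move: volt; rewrite volume_dilate// volD -exprMn => /eqP.
  by rewrite pexpr_eq1// ?mulr_ge0 ?ltW// => /eqP.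
(* The bound for the isotropic dilate, carried back to [D] by homogeneity of degree [m] and
   [t = d^-1]. *)
pose p := 3 / (16 * l) * d ^+ m.
have p0 : 0 < p by rewrite mulr_gt0 ?divr_gt0 ?mulr_gt0// exprn_gt0.
have PDp xi : sphere xi -> p <= projection_function D xi.
  move=> xi1; have := isotropic_projection_ge (@compact_dilate _ _ t _ cD) iso xi1.
  rewrite projection_function_dilate// => h.
  have dm : 0 < d ^+ m by rewrite exprn_gt0.
  have := ler_wpM2l (ltW dm) h.
  by rewrite [leRHS]mulrA -exprMn [d * t]mulrC td expr1n mul1r mulrC.
pose del := eps / p.
have del0 : 0 < del by rewrite divr_gt0.
have PKD' xi : sphere xi -> projection_function K xi <= (1 + del) * projection_function D xi.
  move=> xi1; apply: (le_trans (PKD _ xi1)); rewrite mulrDl mul1r lerD2l.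
  by rewrite /del mulrAC ler_pdivlMr// ler_pM2l// PDp.
have main : k ^+ m * d <= (1 + del) * d ^+ m.+1.
  (* The zonotope is within the factor [(1 + s) ^+ m] of [D]; letting [s] tend to 0 removes this
     loss. *)
  apply: (@ler_expr_limit _ _ _ 1 m) => //.
    by rewrite mulr_ge0// ?exprn_ge0// ?ltW// addr_gt0.
  move=> s s0; rewrite mulr1.
  have [vs [DZ ZD]] := projection_body_zonotope bM DM s0.
  have rho0 : 0 <= (1 + s) ^+ m by rewrite exprn_ge0// addr_ge0// ltW.
  rewrite [leRHS]mulrCA [leRHS]mulrA.
  exact: shephard_zonotope bK sK bD sD rho0 (ltW del0) DZ ZD PKD' k0 d0 volK volD.
have {main} : k ^+ m <= (1 + del) * d ^+ m.
  by rewrite -(ler_pM2r d0) (le_trans main)// exprSr mulrA.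
move=> h; apply: (le_trans h); rewrite mulrDl mul1r lerD2l.
(* The power of [d] in [p] cancels, so the error does not depend on the volume of [D]. *)
have -> : del * d ^+ m = 16 / 3 * eps * l.
  rewrite /del /p; field; rewrite !gt_eqF ?exprn_gt0//.
have hln : ln 2 <= ln (1 + m.+1%:R) :> R.
  have m1 : 1 <= m.+1%:R :> R by rewrite ler1n.
  by rewrite ler_ln ?posrE//; lra.
have l2 : 1 <= ln (1 + m.+1%:R) ^+ 2 / ln (2 : R) ^+ 2.
  rewrite ler_pdivlMr ?exprn_gt0// mul1r ler_pXn2r// nnegrE ltW//.
  exact: lt_le_trans hln.
have X0 : 0 <= 16 / 3 * eps * l by rewrite !mulr_ge0// ltW.
apply: (le_trans (ler_peMr X0 l2)); rewrite le_eqVlt; apply/orP; left; apply/eqP; ring.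
Qed.
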